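(* Let $0<q<1$ and let $U_{(1)}:=u=(u^0,u^1)$ be the $4\times2$ matrix with entries in $\mathcal{O}(S^7_q)$ given in the context. For $n\geq2$, let $U_{(n)}\in M_{4^n\times(n+1)}\big(\mathcal{O}(S^7_q)\big)$ be the matrix with $k$-th column defined recursively by $$U_{(n)}^k=[\![n]\!]^{-\frac12}\Big(q^k[\![n-k]\!]^{\frac12}\,u^0\bullet U_{(n-1)}^k+[\![k]\!]^{\frac12}\,u^1\bullet U_{(n-1)}^{k-1}\Big),\qquad k\in\{0,1,\dots,n\}$$ (with the convention that $U_{(n-1)}^k:=0$ for $k=n$; for $k=0$ the second term vanishes). Then this matrix is a partial isometry and transforms under the coaction $\delta_R$ with the matrix $T_{(n)}$, that is: $$(U_{(n)})^*\,U_{(n)}=1_{n+1},\qquad \delta_R(U_{(n)})=U_{(n)}\,\dot\otimes\,T_{(n)}.$$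
   Context: For a matrix $a$, $a_i^j$ is the entry in row $i$, column $j$, and $a^j$ its $j$-th column; $(a\,\dot\otimes\,b)_i^j=\sum_ka_i^k\otimes b_k^j$; $\delta_R$ is applied to matrices entrywise. For $v\in\mathcal{O}(S^7_q)\otimes\mathbb{C}^m$, $w\in\mathcal{O}(S^7_q)\otimes\mathbb{C}^k$, $v\bullet w\in\mathcal{O}(S^7_q)\otimes\mathbb{C}^{mk}$ has components $v_iw_j$. Let $[\![n]\!]=\frac{1-q^{2n}}{1-q^2}$ and $\genfrac{[}{]}{0pt}{}{n}{k}=\frac{\prod_{i=k+1}^n(1-q^{2i})}{\prod_{j=1}^{n-k}(1-q^{2j})}$ (empty products are $1$). $\mathcal{O}(S^7_q)$ is the unital $*$-algebra over $\mathbb{C}$ generated by $x_i,x_i^*$ ($i=1,\dots,4$) with relations $x_1x_2=qx_2x_1$, $x_1x_3=qx_3x_1$, $x_1x_4=q^2x_4x_1$, $x_2x_3=q^2x_3x_2+q^2(q-q^{-1})x_4x_1$, $x_2x_4=qx_4x_2$, $x_3x_4=qx_4x_3$; $x_1^*x_1=x_1x_1^*$, $x_1^*x_2=qx_2x_1^*$, $x_1^*x_3=qx_3x_1^*$, $x_1^*x_4=q^2x_4x_1^*$, $x_2^*x_2=x_2x_2^*+(1-q^2)x_1x_1^*$, $x_2^*x_3=q^2x_3x_2^*$, $x_2^*x_4=qx_4x_2^*+q^2(q-q^{-1})x_3x_1^*$, $x_3^*x_3=x_3x_3^*+(1-q^4)x_2x_2^*+(1-q^2)x_1x_1^*$, $x_3^*x_4=qx_4x_3^*-q^4(q-q^{-1})x_2x_1^*$;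 $x_1x_1^*+x_2x_2^*+x_3x_3^*+x_4x_4^*=1$, $q^8x_1^*x_1+q^6x_2^*x_2+q^2x_3^*x_3+x_4^*x_4=1$; and the adjoints of all these relations. $\mathcal{O}(SU_q(2))$ is the Hopf $*$-algebra generated by $\alpha,\gamma$ and their adjoints with relations expressing that $T_{(1)}=\begin{pmatrix}\alpha&-q\gamma^*\\ \gamma&\alpha^*\end{pmatrix}$ (rows and columns counted from $0$) is a unitary matrix, and coproduct $\Delta\big((T_{(1)})_i^j\big)=\sum_k(T_{(1)})_i^k\otimes(T_{(1)})_k^j$. It coacts on $\mathcal{O}(S^7_q)$ by the $*$-algebra map $\delta_R$ with $\delta_R(u)=u\,\dot\otimes\,T_{(1)}$, where $$u=\begin{pmatrix} qx_1 & qx_2 \\ -q^2x_2^* & q^3x_1^* \\ -x_3 & x_4 \\ x_4^* & qx_3^* \end{pmatrix}$$ (rows $1,\dots,4$, columns $0,1$); one has $u^*u=1_2$. $T_{(n)}\in M_{n+1}(\mathcal{O}(SU_q(2)))$ (rows and columns counted from $0$) is the standard unitary matrix of the irreducible $(n+1)$-dimensional corepresentation: its column $0$ is $(T_{(n)})_k^0=\genfrac{[}{]}{0pt}{}{n}{k}^{1/2}\gamma^k\alpha^{n-k}$, $0\le k\le n$ (linearly independent elements), and the remaining entries are determined uniquely by $\Delta\big((T_{(n)})_k^0\big)=\sum_{j=0}^n(T_{(n)})_k^j\otimes(T_{(n)})_j^0$. *)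

(* Defs.v *)
From HB Require Import structures.
From mathcomp Require Import all_boot all_order all_algebra.
From mathcomp Require Import complex.
From mathcomp Require Import boolp classical_sets reals.

Set Implicit Arguments.
Unset Strict Implicit.
Unset Printing Implicit Defensive.

Import Order.TTheory GRing.Theory Num.Theory.

Local Open Scope quotient_scope.
Local Open Scope ring_scope.

HB.mixin Record Algebra_isStarAlgebra (C : numClosedFieldType) A
    of GRing.Algebra C A := {
  star : A -> A;
  starK : involutive star;
  starD : {morph star : a b / a + b};
  starZ : forall (c : C) (a : A), star (c *: a) = c^* *: star a;
  starM : forall a b : A, star (a * b) = star b * star a
}.

#[short(type="starAlgType")]
HB.structure Definition StarAlgebra (C : numClosedFieldType) :=
  {A of GRing.Algebra C A & Algebra_isStarAlgebra C A}.

HB.mixin Record isStarMorphism (C : numClosedFieldType) (A B : starAlgType C)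
    (f : A -> B) := {
  star_morph : {morph f : a / star a}
}.

#[short(type="starMorphism")]
HB.structure Definition StarMorphism (C : numClosedFieldType)
    (A B : starAlgType C) :=
  {f of @GRing.LRMorphism C A B *:%R f & isStarMorphism C A B f}.

HB.instance Definition _ (C : numClosedFieldType) :=
  Algebra_isStarAlgebra.Build C C^o (@conjCK C) (rmorphD Num.conj)
    (rmorphM Num.conj)
    (fun a b => etrans (rmorphM Num.conj a b) (mulrC _ _)).

Lemma star0 (C : numClosedFieldType) (A : starAlgType C) : star 0 = 0 :> A.
Proof. by have := starZ 0 (0 : A); rewrite conjC0 !scale0r. Qed.

Lemma starN (C : numClosedFieldType) (A : starAlgType C) :
  {morph @star C A : a / - a}.
Proof. by move=> a; rewrite -scaleN1r starZ rmorphN1 scaleN1r. Qed.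

Lemma star1 (C : numClosedFieldType) (A : starAlgType C) : star 1 = 1 :> A.
Proof. by rewrite -[LHS]mul1r -[X in X * _ = _]starK -starM mul1r starK. Qed.

Definition adjmx (C : numClosedFieldType) (A : starAlgType C) m n
  (M : 'M[A]_(m, n)) : 'M[A]_(n, m) := (map_mx star M)^T.

(* (v • w)_(i, j) = v_i w_j, the pairs (i, j) being ordered
   lexicographically. *)
Definition bulletmx (A : pzRingType) m n (v : 'cV[A]_m) (w : 'cV[A]_n) :
  'cV[A]_(m * n) := (mxvec (\matrix_(i < m, j < n) (v i 0 * w j 0)))^T.

Inductive staterm (C I : Type) : Type :=
| TGen of I
| TZero
| TOne
| TAdd of staterm C I & staterm C I
| TOpp of staterm C I
| TScale of C & staterm C I
| TMul of staterm C I & staterm C I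
| TStar of staterm C I.
Arguments TGen {C I}.
Arguments TZero {C I}.
Arguments TOne {C I}.

Declare Scope staterm_scope.
Delimit Scope staterm_scope with sta.
Bind Scope staterm_scope with staterm.
Notation "0" := TZero : staterm_scope.
Notation "1" := TOne : staterm_scope.
Notation "s + t" := (TAdd s t) : staterm_scope.
Notation "- s" := (TOpp s) : staterm_scope.
Notation "s - t" := (TAdd s (TOpp t)) : staterm_scope.
Notation "c *: s" := (TScale c%R s) : staterm_scope.
Notation "s * t" := (TMul s t) : staterm_scope.
Notation "s ^*" := (TStar s) : staterm_scope.

(* The smallest congruence containing [rel] and the axioms of unital
   *-algebras.  Compatibility with [TStar] makes the adjoint of every
   relation hold as well. *)
Inductive stacongr (C : numClosedFieldType) (I : Type)
    (rel : staterm C I -> staterm C I -> Prop) :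
    staterm C I -> staterm C I -> Prop :=
| sta_rel s t : rel s t -> stacongr rel s t
| sta_refl s : stacongr rel s s
| sta_sym s t : stacongr rel s t -> stacongr rel t s
| sta_trans s t r : stacongr rel s t -> stacongr rel t r -> stacongr rel s r
| sta_add s s' t t' :
    stacongr rel s s' -> stacongr rel t t' -> stacongr rel (s + t) (s' + t')
| sta_opp s s' : stacongr rel s s' -> stacongr rel (- s) (- s')
| sta_scale c s s' : stacongr rel s s' -> stacongr rel (c *: s) (c *: s')
| sta_mul s s' t t' :
    stacongr rel s s' -> stacongr rel t t' -> stacongr rel (s * t) (s' * t')
| sta_star s s' : stacongr rel s s' -> stacongr rel (s^*) (s'^*)
| sta_addA s t r : stacongr rel (s + (t + r)) ((s + t) + r)
| sta_addC s t : stacongr rel (s + t) (t + s)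
| sta_add0 s : stacongr rel (0 + s) s
| sta_addN s : stacongr rel (- s + s) 0
| sta_mulA s t r : stacongr rel (s * (t * r)) ((s * t) * r)
| sta_mul1l s : stacongr rel (1 * s) s
| sta_mul1r s : stacongr rel (s * 1) s
| sta_mulDl s t r : stacongr rel ((s + t) * r) (s * r + t * r)
| sta_mulDr s t r : stacongr rel (s * (t + r)) (s * t + s * r)
| sta_scaleA c d s : stacongr rel (c *: (d *: s)) ((c * d) *: s)
| sta_scale1 s : stacongr rel (1 *: s) s
| sta_scaleDr c s t : stacongr rel (c *: (s + t)) (c *: s + c *: t)
| sta_scaleDl c d s : stacongr rel ((c + d) *: s) (c *: s + d *: s)
| sta_scaleAl c s t : stacongr rel (c *: (s * t)) ((c *: s) * t)
| sta_scaleAr c s t : stacongr rel (c *: (s * t)) (s * (c *: t))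
| sta_starK s : stacongr rel ((s^*)^*) s
| sta_starD s t : stacongr rel ((s + t)^*) (s^* + t^*)
| sta_starZ c s : stacongr rel ((c *: s)^*) (c^* *: s^*)
| sta_starM s t : stacongr rel ((s * t)^*) (t^* * s^*).

HB.instance Definition _ (C I : Type) := gen_eqMixin (staterm C I).
HB.instance Definition _ (C I : Type) := gen_choiceMixin (staterm C I).

Section Presented.
Variables (C : numClosedFieldType) (I : Type).
Variable rel : staterm C I -> staterm C I -> Prop.

Definition staeq (s t : staterm C I) : bool := `[< stacongr rel s t >].

Lemma staeq_refl : reflexive staeq.
Proof. by move=> s; apply/asboolP; apply: sta_refl. Qed.

Lemma staeq_sym : symmetric staeq.
Proof. by move=> s t; apply/asboolP/asboolP; apply: sta_sym. Qed.

Lemma staeq_trans : transitive staeq.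
Proof.
by move=> t s r /asboolP h1 /asboolP h2; apply/asboolP; apply: sta_trans h1 h2.
Qed.

Canonical staeq_equiv := EquivRel staeq staeq_refl staeq_sym staeq_trans.

Definition presented : Type := {eq_quot staeq}.

HB.instance Definition _ := Choice.on presented.
HB.instance Definition _ := EqQuotient.on presented.

Definition pclass (s : staterm C I) : presented := \pi_presented s.
Definition pgen (i : I) : presented := pclass (TGen i).

Lemma pclassP s t : pclass s = pclass t <-> stacongr rel s t.
Proof.
split=> [/eqP|h]; first by rewrite /pclass eqmodE => /asboolP.
by apply/eqP; rewrite /pclass eqmodE; apply/asboolP.
Qed.

Lemma pclassW (P : presented -> Prop) :
  (forall s, P (pclass s)) -> forall x, P x.
Proof. by move=> h x; elim/quotW: x. Qed.

Lemma repr_pclass s : stacongr rel (repr (pclass s)) s.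
Proof. by apply/pclassP; rewrite /pclass reprK. Qed.

Definition padd (x y : presented) := pclass (repr x + repr y).
Definition popp (x : presented) := pclass (- repr x).
Definition pmul (x y : presented) := pclass (repr x * repr y).
Definition pscale c (x : presented) := pclass (c *: repr x).

Fact paddE s t : padd (pclass s) (pclass t) = pclass (s + t).
Proof. by apply/pclassP; apply: sta_add; apply: repr_pclass. Qed.
Fact poppE s : popp (pclass s) = pclass (- s).
Proof. by apply/pclassP; apply: sta_opp; apply: repr_pclass. Qed.
Fact pmulE s t : pmul (pclass s) (pclass t) = pclass (s * t).
Proof. by apply/pclassP; apply: sta_mul; apply: repr_pclass. Qed.
Fact pscaleE c s : pscale c (pclass s) = pclass (c *: s).
Proof. by apply/pclassP; apply: sta_scale; apply: repr_pclass. Qed.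

Fact paddA : associative padd.
Proof.
elim/pclassW=> s; elim/pclassW=> t; elim/pclassW=> r.
by rewrite !paddE; apply/pclassP; apply: sta_addA.
Qed.
Fact paddC : commutative padd.
Proof.
elim/pclassW=> s; elim/pclassW=> t.
by rewrite !paddE; apply/pclassP; apply: sta_addC.
Qed.
Fact padd0 : left_id (pclass 0) padd.
Proof.
by elim/pclassW=> s; rewrite !paddE; apply/pclassP; apply: sta_add0.
Qed.
Fact paddN : left_inverse (pclass 0) popp padd.
Proof.
by elim/pclassW=> s; rewrite poppE !paddE; apply/pclassP; apply: sta_addN.
Qed.

HB.instance Definition _ := GRing.isZmodule.Build presented paddA paddC padd0 paddN.

Fact pmulA : associative pmul.
Proof.
elim/pclassW=> s; elim/pclassW=> t; elim/pclassW=> r.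
by rewrite !pmulE; apply/pclassP; apply: sta_mulA.
Qed.
Fact pmul1l : left_id (pclass 1) pmul.
Proof.
by elim/pclassW=> s; rewrite !pmulE; apply/pclassP; apply: sta_mul1l.
Qed.
Fact pmul1r : right_id (pclass 1) pmul.
Proof.
by elim/pclassW=> s; rewrite !pmulE; apply/pclassP; apply: sta_mul1r.
Qed.
Fact pmulDl : left_distributive pmul +%R.
Proof.
elim/pclassW=> s; elim/pclassW=> t; elim/pclassW=> r.
rewrite -[(_ + _ : presented)]/(padd _ _) -[RHS]/(padd _ _).
by rewrite !(paddE, pmulE); apply/pclassP; apply: sta_mulDl.
Qed.
Fact pmulDr : right_distributive pmul +%R.
Proof.
elim/pclassW=> s; elim/pclassW=> t; elim/pclassW=> r.
rewrite -[(_ + _ : presented)]/(padd _ _) -[RHS]/(padd _ _).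
by rewrite !(paddE, pmulE); apply/pclassP; apply: sta_mulDr.
Qed.

HB.instance Definition _ :=
  GRing.Zmodule_isPzRing.Build presented pmulA pmul1l pmul1r pmulDl pmulDr.

Fact pscaleA c d x : pscale c (pscale d x) = pscale (c * d) x.
Proof.
elim/pclassW: x => s.
by rewrite !pscaleE; apply/pclassP; apply: sta_scaleA.
Qed.
Fact pscale1 : left_id 1 pscale.
Proof.
by elim/pclassW=> s; rewrite !pscaleE; apply/pclassP; apply: sta_scale1.
Qed.
Fact pscaleDr : right_distributive pscale +%R.
Proof.
move=> c; elim/pclassW=> s; elim/pclassW=> t.
rewrite -[(_ + _ : presented)]/(padd _ _) -[RHS]/(padd _ _).
by rewrite !(paddE, pscaleE); apply/pclassP; apply: sta_scaleDr.
Qed.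
Fact pscaleDl x : {morph pscale^~ x : c d / c + d}.
Proof.
move=> c d; elim/pclassW: x => s; rewrite -[RHS]/(padd _ _).
by rewrite !(paddE, pscaleE); apply/pclassP; apply: sta_scaleDl.
Qed.

HB.instance Definition _ :=
  GRing.Zmodule_isLmodule.Build C presented pscaleA pscale1 pscaleDr pscaleDl.

Lemma pclass0 : pclass 0 = 0. Proof. by []. Qed.
Lemma pclass1 : pclass 1 = 1. Proof. by []. Qed.
Lemma pclassD s t : pclass (s + t) = pclass s + pclass t.
Proof. exact/esym/paddE. Qed.
Lemma pclassN s : pclass (- s) = - pclass s.
Proof. exact/esym/poppE. Qed.
Lemma pclassM s t : pclass (s * t) = pclass s * pclass t.
Proof. exact/esym/pmulE. Qed.
Lemma pclassZ c s : pclass (c *: s) = c *: pclass s.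
Proof. exact/esym/pscaleE. Qed.

Definition pstar (x : presented) : presented := pclass ((repr x)^*).

Lemma pclass_star s : pclass (s^*) = pstar (pclass s).
Proof. by apply/esym/pclassP; apply: sta_star; apply: repr_pclass. Qed.

Lemma pscaleAl (c : C) (a b : presented) : c *: (a * b) = (c *: a) * b.
Proof.
elim/pclassW: a => s; elim/pclassW: b => t.
by rewrite -!(pclassM, pclassZ); apply/pclassP; apply: sta_scaleAl.
Qed.
Lemma pscaleAr (c : C) (a b : presented) : c *: (a * b) = a * (c *: b).
Proof.
elim/pclassW: a => s; elim/pclassW: b => t.
by rewrite -!(pclassM, pclassZ); apply/pclassP; apply: sta_scaleAr.
Qed.
Lemma pstarK : involutive pstar.
Proof.
by elim/pclassW=> s; rewrite -!pclass_star; apply/pclassP; apply: sta_starK.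
Qed.
Lemma pstarD : {morph pstar : a b / a + b}.
Proof.
elim/pclassW=> s; elim/pclassW=> t.
by rewrite -pclassD -!pclass_star -pclassD; apply/pclassP; apply: sta_starD.
Qed.
Lemma pstarZ (c : C) (a : presented) : pstar (c *: a) = c^* *: pstar a.
Proof.
elim/pclassW: a => s.
by rewrite -pclassZ -!pclass_star -pclassZ; apply/pclassP; apply: sta_starZ.
Qed.
Lemma pstarM (a b : presented) : pstar (a * b) = pstar b * pstar a.
Proof.
elim/pclassW: a => s; elim/pclassW: b => t.
by rewrite -pclassM -!pclass_star -pclassM; apply/pclassP; apply: sta_starM.
Qed.

Section Eval.
Variables (B : starAlgType C) (g : I -> B).

Fixpoint staeval (s : staterm C I) : B :=
  match s with
  | TGen i => g i
  | TZero => 0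
  | TOne => 1
  | TAdd s t => staeval s + staeval t
  | TOpp s => - staeval s
  | TScale c s => c *: staeval s
  | TMul s t => staeval s * staeval t
  | TStar s => star (staeval s)
  end.

Hypothesis relg : forall s t, rel s t -> staeval s = staeval t.

Lemma staeval_congr s t : stacongr rel s t -> staeval s = staeval t.
Proof.
elim=> //=.
- by move=> ? ? ? _ -> _ ->.
- by move=> ? ? ? ? _ -> _ ->.
- by move=> ? ? _ ->.
- by move=> ? ? ? _ ->.
- by move=> ? ? ? ? _ -> _ ->.
- by move=> ? ? _ ->.
- by move=> *; rewrite addrA.
- by move=> *; rewrite addrC.
- by move=> *; rewrite add0r.
- by move=> *; rewrite addNr.
- by move=> *; rewrite mulrA.
- by move=> *; rewrite mul1r.
- by move=> *; rewrite mulr1.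
- by move=> *; rewrite mulrDl.
- by move=> *; rewrite mulrDr.
- by move=> *; rewrite scalerA.
- by move=> *; rewrite scale1r.
- by move=> *; rewrite scalerDr.
- by move=> *; rewrite scalerDl.
- by move=> *; rewrite scalerAl.
- by move=> *; rewrite scalerAr.
- by move=> *; rewrite starK.
- by move=> *; rewrite starD.
- by move=> *; rewrite starZ.
- by move=> *; rewrite starM.
Qed.

Lemma presented_neq0 : (1 : presented) != 0.
Proof.
apply/eqP; rewrite -pclass1 -pclass0 => /pclassP /staeval_congr /= /eqP.
by rewrite oner_eq0.
Qed.

End Eval.
End Presented.

Lemma exists_linear_form (C : fieldType) (V : lmodType C) (v : V) :
  v != 0 -> exists2 f : {linear V -> C^o}, True & f v = 1.
Proof.
move=> v0.
pose lin (A : set V) := forall c a b, A a -> A b -> A (c *: a + b).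
pose P : set (set V) := fun A => lin A /\ ~ A v.
have [F FP totF|A [[linA Av] maxA]] := @Zorn_bigcup V P.
  split=> [c a b [X FX Xa] [Y FY Yb]|[X FX Xv]]; last by case: (FP X FX).
  case: (totF X Y FX FY) => XY.
    by exists Y => //; apply: (FP Y FY).1 => //; apply: XY.
  by exists X => //; apply: (FP X FX).1 => //; apply: XY.
have A0 : A 0.
  apply: contrapT => nA0; apply: (maxA (fun x => x = 0)).
    split=> [x Ax|]; last by move=> /(_ 0 erefl).
    by case: nA0; rewrite -(addNr x) -scaleN1r; apply: (linA).
  split=> [c a b -> ->|/eqP]; first by rewrite scaler0 addr0.
  by rewrite (negbTE v0).
have AZ c x : A x -> A (c *: x) by move=> Ax; rewrite -[_ *: _]addr0; apply: (linA).
have AD x y : A x -> A y -> A (x + y) by move=> Ax; rewrite -[x]scale1r; apply: (linA).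
have ex x : exists c, A (x - c *: v).
  apply: contrapT => nx.
  have nAx : ~ A x by move=> Ax; apply: nx; exists 0; rewrite scale0r subr0.
  apply: (maxA (fun y => exists d, A (y - d *: x))).
    split=> [y Ay|]; first by exists 0; rewrite scale0r subr0.
    by move=> /(_ x) h; apply/nAx/h; exists 1; rewrite scale1r subrr.
  split=> [c a b [d Ad] [e Ae]|[d Ad]].
    exists (c * d + e); rewrite scalerDl -scalerA opprD addrACA -scalerBr.
    exact: (linA).
  have d0 : d != 0.
    by apply: contra_notN Av => /eqP d0; move: Ad; rewrite d0 scale0r subr0.
  apply: nx; exists d^-1; rewrite -[x in x - _](scalerK d0) -scalerBr.
  by rewrite -opprB scalerN -scaleNr; apply: (AZ).
have uniqc x c d : A (x - c *: v) -> A (x - d *: v) -> c = d.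
  move=> Ac Ad; apply/eqP; rewrite -subr_eq0; apply/negPn/negP => cd.
  apply: Av; rewrite -[v](scalerK cd); apply: (AZ).
  have -> : (c - d) *: v = (x - d *: v) + (-1) *: (x - c *: v).
    by rewrite scalerBl scaleN1r opprB [RHS]addrC addrA subrK.
  by apply: (AD) => //; apply: (AZ).
pose f x : C^o := sval (cid (ex x)).
have fA x : A (x - f x *: v) by rewrite /f; case: cid.
have flin : linear f.
  move=> c x y; apply: (uniqc (c *: x + y)) => //.
  rewrite scalerDl -scalerA opprD addrACA -scalerBr.
  exact: (linA).
pose fL : {linear V -> C^o} := HB.pack f (GRing.isLinear.Build C V C^o _ f flin).
exists fL => //; apply: (uniqc v (f v) 1); first exact: (fA v).
by rewrite scale1r subrr.
Qed.

(* As a vector space, the free vector space on symbols [a ⊗ b] modulo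
   bilinearity; product and involution are
   (a ⊗ b)(a' ⊗ b') = aa' ⊗ bb' and (a ⊗ b)^* = a^* ⊗ b^*. *)
Inductive tensterm (C A B : Type) : Type :=
| XPure of A & B
| XZero
| XAdd of tensterm C A B & tensterm C A B
| XOpp of tensterm C A B
| XScale of C & tensterm C A B.
Arguments XPure {C A B}.
Arguments XZero {C A B}.

HB.instance Definition _ (C A B : Type) := gen_eqMixin (tensterm C A B).
HB.instance Definition _ (C A B : Type) := gen_choiceMixin (tensterm C A B).

Inductive tenscongr (C : pzRingType) (A B : lmodType C) :
    tensterm C A B -> tensterm C A B -> Prop :=
| tens_refl s : tenscongr s s
| tens_sym s t : tenscongr s t -> tenscongr t s
| tens_trans s t r : tenscongr s t -> tenscongr t r -> tenscongr s r
| tens_add s s' t t' :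
    tenscongr s s' -> tenscongr t t' -> tenscongr (XAdd s t) (XAdd s' t')
| tens_opp s s' : tenscongr s s' -> tenscongr (XOpp s) (XOpp s')
| tens_scale c s s' : tenscongr s s' -> tenscongr (XScale c s) (XScale c s')
| tens_addA s t r : tenscongr (XAdd s (XAdd t r)) (XAdd (XAdd s t) r)
| tens_addC s t : tenscongr (XAdd s t) (XAdd t s)
| tens_add0 s : tenscongr (XAdd XZero s) s
| tens_addN s : tenscongr (XAdd (XOpp s) s) XZero
| tens_scaleA c d s : tenscongr (XScale c (XScale d s)) (XScale (c * d) s)
| tens_scale1 s : tenscongr (XScale 1 s) s
| tens_scaleDr c s t :
    tenscongr (XScale c (XAdd s t)) (XAdd (XScale c s) (XScale c t))
| tens_scaleDl c d s :
    tenscongr (XScale (c + d) s) (XAdd (XScale c s) (XScale d s))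
| tens_pureDl a a' b :
    tenscongr (XPure (a + a') b) (XAdd (XPure a b) (XPure a' b))
| tens_pureDr a b b' :
    tenscongr (XPure a (b + b')) (XAdd (XPure a b) (XPure a b'))
| tens_pureZl c a b : tenscongr (XPure (c *: a) b) (XScale c (XPure a b))
| tens_pureZr c a b : tenscongr (XPure a (c *: b)) (XScale c (XPure a b)).

Section TensorModule.
Variables (C : pzRingType) (A B : lmodType C).

Definition tenseq (s t : tensterm C A B) : bool := `[< tenscongr s t >].

Lemma tenseq_refl : reflexive tenseq.
Proof. by move=> s; apply/asboolP; apply: tens_refl. Qed.

Lemma tenseq_sym : symmetric tenseq.
Proof. by move=> s t; apply/asboolP/asboolP; apply: tens_sym. Qed.

Lemma tenseq_trans : transitive tenseq.
Proof.
by move=> t s r /asboolP h1 /asboolP h2; apply/asboolP; apply: tens_trans h1 h2.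
Qed.

Canonical tenseq_equiv := EquivRel tenseq tenseq_refl tenseq_sym tenseq_trans.

Definition tensor : Type := {eq_quot tenseq}.

HB.instance Definition _ := Choice.on tensor.
HB.instance Definition _ := EqQuotient.on tensor.

Definition tclass (s : tensterm C A B) : tensor := \pi_tensor s.
Definition tens (a : A) (b : B) : tensor := tclass (XPure a b).

Lemma tclassP s t : tclass s = tclass t <-> tenscongr s t.
Proof.
split=> [/eqP|h]; first by rewrite /tclass eqmodE => /asboolP.
by apply/eqP; rewrite /tclass eqmodE; apply/asboolP.
Qed.

Lemma tclassW (P : tensor -> Prop) : (forall s, P (tclass s)) -> forall x, P x.
Proof. by move=> h x; elim/quotW: x. Qed.

Lemma repr_tclass s : tenscongr (repr (tclass s)) s.
Proof. by apply/tclassP; rewrite /tclass reprK. Qed.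

Definition tadd (x y : tensor) := tclass (XAdd (repr x) (repr y)).
Definition topp (x : tensor) := tclass (XOpp (repr x)).
Definition tscale c (x : tensor) := tclass (XScale c (repr x)).

Fact taddE s t : tadd (tclass s) (tclass t) = tclass (XAdd s t).
Proof. by apply/tclassP; apply: tens_add; apply: repr_tclass. Qed.
Fact toppE s : topp (tclass s) = tclass (XOpp s).
Proof. by apply/tclassP; apply: tens_opp; apply: repr_tclass. Qed.
Fact tscaleE c s : tscale c (tclass s) = tclass (XScale c s).
Proof. by apply/tclassP; apply: tens_scale; apply: repr_tclass. Qed.

Fact taddA : associative tadd.
Proof.
elim/tclassW=> s; elim/tclassW=> t; elim/tclassW=> r.
by rewrite !taddE; apply/tclassP; apply: tens_addA.
Qed.
Fact taddC : commutative tadd.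
Proof.
elim/tclassW=> s; elim/tclassW=> t.
by rewrite !taddE; apply/tclassP; apply: tens_addC.
Qed.
Fact tadd0 : left_id (tclass XZero) tadd.
Proof.
by elim/tclassW=> s; rewrite !taddE; apply/tclassP; apply: tens_add0.
Qed.
Fact taddN : left_inverse (tclass XZero) topp tadd.
Proof.
by elim/tclassW=> s; rewrite toppE !taddE; apply/tclassP; apply: tens_addN.
Qed.

HB.instance Definition _ := GRing.isZmodule.Build tensor taddA taddC tadd0 taddN.

Fact tscaleA c d x : tscale c (tscale d x) = tscale (c * d) x.
Proof.
elim/tclassW: x => s.
by rewrite !tscaleE; apply/tclassP; apply: tens_scaleA.
Qed.
Fact tscale1 : left_id 1 tscale.
Proof.
by elim/tclassW=> s; rewrite !tscaleE; apply/tclassP; apply: tens_scale1.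
Qed.
Fact tscaleDr : right_distributive tscale +%R.
Proof.
move=> c; elim/tclassW=> s; elim/tclassW=> t.
rewrite -[(_ + _ : tensor)]/(tadd _ _) -[RHS]/(tadd _ _).
by rewrite !(taddE, tscaleE); apply/tclassP; apply: tens_scaleDr.
Qed.
Fact tscaleDl x : {morph tscale^~ x : c d / c + d}.
Proof.
move=> c d; elim/tclassW: x => s; rewrite -[RHS]/(tadd _ _).
by rewrite !(taddE, tscaleE); apply/tclassP; apply: tens_scaleDl.
Qed.

HB.instance Definition _ :=
  GRing.Zmodule_isLmodule.Build C tensor tscaleA tscale1 tscaleDr tscaleDl.

Lemma tclass0 : tclass XZero = 0. Proof. by []. Qed.
Lemma tclassD s t : tclass (XAdd s t) = tclass s + tclass t.
Proof. exact/esym/taddE. Qed.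
Lemma tclassN s : tclass (XOpp s) = - tclass s.
Proof. exact/esym/toppE. Qed.
Lemma tclassZ c s : tclass (XScale c s) = c *: tclass s.
Proof. exact/esym/tscaleE. Qed.

Lemma tensDl a a' b : tens (a + a') b = tens a b + tens a' b.
Proof. by rewrite -tclassD; apply/tclassP; apply: tens_pureDl. Qed.
Lemma tensDr a b b' : tens a (b + b') = tens a b + tens a b'.
Proof. by rewrite -tclassD; apply/tclassP; apply: tens_pureDr. Qed.
Lemma tensZl c a b : tens (c *: a) b = c *: tens a b.
Proof. by rewrite -tclassZ; apply/tclassP; apply: tens_pureZl. Qed.
Lemma tensZr c a b : tens a (c *: b) = c *: tens a b.
Proof. by rewrite -tclassZ; apply/tclassP; apply: tens_pureZr. Qed.

Lemma tensor_ind (P : tensor -> Prop) :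
    (forall a b, P (tens a b)) -> P 0 ->
    (forall x y, P x -> P y -> P (x + y)) ->
    (forall c x, P x -> P (c *: x)) ->
  forall x, P x.
Proof.
move=> Pp P0 PD PZ; elim/tclassW; elim=> [a b||s Ps t Pt|s Ps|c s Ps].
- exact: Pp.
- by rewrite tclass0.
- by rewrite tclassD; apply: PD.
- by rewrite tclassN -scaleN1r; apply: PZ.
- by rewrite tclassZ; apply: PZ.
Qed.

(* The map A ⊗ B -> V induced by a map A * B -> V that is biadditive and
   homogeneous for the twist [phi] of the scalars. *)
Section Lift.
Variables (V : lmodType C) (phi : {rmorphism C -> C}) (f : A -> B -> V).

Fixpoint tlift_term (s : tensterm C A B) : V :=
  match s with
  | XPure a b => f a b
  | XZero => 0
  | XAdd s t => tlift_term s + tlift_term t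
  | XOpp s => - tlift_term s
  | XScale c s => phi c *: tlift_term s
  end.

Definition tlift (x : tensor) : V := tlift_term (repr x).

Hypothesis fDl : forall a a' b, f (a + a') b = f a b + f a' b.
Hypothesis fDr : forall a b b', f a (b + b') = f a b + f a b'.
Hypothesis fZl : forall c a b, f (c *: a) b = phi c *: f a b.
Hypothesis fZr : forall c a b, f a (c *: b) = phi c *: f a b.

Lemma tlift_congr s t : tenscongr s t -> tlift_term s = tlift_term t.
Proof.
elim=> //=.
- by move=> ? ? ? _ -> _ ->.
- by move=> ? ? ? ? _ -> _ ->.
- by move=> ? ? _ ->.
- by move=> ? ? ? _ ->.
- by move=> *; rewrite addrA.
- by move=> *; rewrite addrC.
- by move=> *; rewrite add0r.
- by move=> *; rewrite addNr.
- by move=> *; rewrite scalerA rmorphM.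
- by move=> *; rewrite rmorph1 scale1r.
- by move=> *; rewrite scalerDr.
- by move=> *; rewrite rmorphD scalerDl.
Qed.

Lemma tlift_class s : tlift (tclass s) = tlift_term s.
Proof. exact/tlift_congr/repr_tclass. Qed.

Lemma tlift_tens a b : tlift (tens a b) = f a b.
Proof. by rewrite tlift_class. Qed.

Lemma tlift0 : tlift 0 = 0.
Proof. by rewrite -tclass0 tlift_class. Qed.

Lemma tliftD : {morph tlift : x y / x + y}.
Proof.
elim/tclassW=> s; elim/tclassW=> t.
by rewrite -tclassD !tlift_class.
Qed.

Lemma tliftZ c x : tlift (c *: x) = phi c *: tlift x.
Proof. by elim/tclassW: x => s; rewrite -tclassZ !tlift_class. Qed.

End Lift.
End TensorModule.

Notation "a *t b" := (tens a b) (at level 40, left associativity) : ring_scope.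

Section TensorAlgebra.
Variables (C : numClosedFieldType) (A B : starAlgType C).

Local Notation AB := (tensor A B).

Definition tmulp (a : A) (b : B) (y : AB) : AB :=
  tlift (@idfun C) (fun a' b' => (a * a') *t (b * b')) y.

Fact tmulp_tens a b a' b' : tmulp a b (a' *t b') = (a * a') *t (b * b').
Proof.
by apply: tlift_tens => *;
  rewrite ?mulrDr ?tensDl ?tensDr // -?scalerAr ?tensZl ?tensZr.
Qed.
Fact tmulpD a b : {morph tmulp a b : x y / x + y}.
Proof.
by apply: tliftD => *;
  rewrite ?mulrDr ?tensDl ?tensDr // -?scalerAr ?tensZl ?tensZr.
Qed.
Fact tmulpZ a b c x : tmulp a b (c *: x) = c *: tmulp a b x.
Proof.
by apply: tliftZ => *;
  rewrite ?mulrDr ?tensDl ?tensDr // -?scalerAr ?tensZl ?tensZr.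
Qed.
Fact tmulp0 a b : tmulp a b 0 = 0.
Proof.
by apply: tlift0 => *;
  rewrite ?mulrDr ?tensDl ?tensDr // -?scalerAr ?tensZl ?tensZr.
Qed.

Fact tmulpDl a a' b y : tmulp (a + a') b y = tmulp a b y + tmulp a' b y.
Proof.
elim/tensor_ind: y => [a0 b0||x y hx hy|c x hx].
- by rewrite !tmulp_tens mulrDl tensDl.
- by rewrite !tmulp0 addr0.
- by rewrite !tmulpD hx hy addrACA.
- by rewrite !tmulpZ hx scalerDr.
Qed.
Fact tmulpDr a b b' y : tmulp a (b + b') y = tmulp a b y + tmulp a b' y.
Proof.
elim/tensor_ind: y => [a0 b0||x y hx hy|c x hx].
- by rewrite !tmulp_tens mulrDl tensDr.
- by rewrite !tmulp0 addr0.
- by rewrite !tmulpD hx hy addrACA.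
- by rewrite !tmulpZ hx scalerDr.
Qed.
Fact tmulpZl c a b y : tmulp (c *: a) b y = c *: tmulp a b y.
Proof.
elim/tensor_ind: y => [a0 b0||x y hx hy|d x hx].
- by rewrite !tmulp_tens -scalerAl tensZl.
- by rewrite !tmulp0 scaler0.
- by rewrite !tmulpD hx hy scalerDr.
- by rewrite !tmulpZ hx !scalerA mulrC.
Qed.
Fact tmulpZr c a b y : tmulp a (c *: b) y = c *: tmulp a b y.
Proof.
elim/tensor_ind: y => [a0 b0||x y hx hy|d x hx].
- by rewrite !tmulp_tens -scalerAl tensZr.
- by rewrite !tmulp0 scaler0.
- by rewrite !tmulpD hx hy scalerDr.
- by rewrite !tmulpZ hx !scalerA mulrC.
Qed.

Definition tmul (x y : AB) : AB := tlift (@idfun C) (fun a b => tmulp a b y) x.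

Fact tmul_pure a b y : tmul (a *t b) y = tmulp a b y.
Proof.
by apply: tlift_tens => *;
  rewrite ?(tmulpDl, tmulpDr, tmulpZl, tmulpZr).
Qed.
Fact tmulDl : left_distributive tmul +%R.
Proof.
by move=> x x' y; apply: tliftD => *;
  rewrite ?(tmulpDl, tmulpDr, tmulpZl, tmulpZr).
Qed.
Fact tmulZl c x y : tmul (c *: x) y = c *: tmul x y.
Proof.
by apply: tliftZ => *;
  rewrite ?(tmulpDl, tmulpDr, tmulpZl, tmulpZr).
Qed.
Fact tmul0l y : tmul 0 y = 0.
Proof.
by apply: tlift0 => *;
  rewrite ?(tmulpDl, tmulpDr, tmulpZl, tmulpZr).
Qed.

Fact tmulDr : right_distributive tmul +%R.
Proof.
move=> x y y'; elim/tensor_ind: x => [a b||x x' hx hx'|c x hx].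
- by rewrite !tmul_pure tmulpD.
- by rewrite !tmul0l addr0.
- by rewrite !tmulDl hx hx' addrACA.
- by rewrite !tmulZl hx scalerDr.
Qed.
Fact tmulZr c x y : tmul x (c *: y) = c *: tmul x y.
Proof.
elim/tensor_ind: x => [a b||x x' hx hx'|d x hx].
- by rewrite !tmul_pure tmulpZ.
- by rewrite !tmul0l scaler0.
- by rewrite !tmulDl hx hx' scalerDr.
- by rewrite !tmulZl hx !scalerA mulrC.
Qed.
Fact tmul0r x : tmul x 0 = 0.
Proof. by rewrite -(scale0r (0 : AB)) tmulZr !scale0r. Qed.

Fact tmul_tens a b a' b' : tmul (a *t b) (a' *t b') = (a * a') *t (b * b').
Proof. by rewrite tmul_pure tmulp_tens. Qed.

Fact tmulA : associative tmul.
Proof.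
move=> x y z; elim/tensor_ind: x => [a b||x x' hx hx'|c x hx]; last 1 first.
- by rewrite !tmulZl hx.
- elim/tensor_ind: y => [a' b'||y y' hy hy'|c y hy]; last 1 first.
  + by rewrite !(tmulZl, tmulZr) hy.
  + elim/tensor_ind: z => [a'' b''||z z' hz hz'|c z hz].
    * by rewrite !tmul_tens !mulrA.
    * by rewrite !tmul0r.
    * by rewrite !tmulDr hz hz'.
    * by rewrite !tmulZr hz.
  + by rewrite !(tmul0l, tmul0r).
  + by rewrite !(tmulDl, tmulDr) hy hy'.
- by rewrite !tmul0l.
- by rewrite !tmulDl hx hx'.
Qed.
Fact tmul1l : left_id (1 *t 1) tmul.
Proof.
elim/tensor_ind=> [a b||x y hx hy|c x hx].
- by rewrite tmul_tens !mul1r.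
- by rewrite tmul0r.
- by rewrite tmulDr hx hy.
- by rewrite tmulZr hx.
Qed.
Fact tmul1r : right_id (1 *t 1) tmul.
Proof.
elim/tensor_ind=> [a b||x y hx hy|c x hx].
- by rewrite tmul_tens !mulr1.
- by rewrite tmul0l.
- by rewrite tmulDl hx hy.
- by rewrite tmulZl hx.
Qed.

HB.instance Definition _ :=
  GRing.Zmodule_isPzRing.Build AB tmulA tmul1l tmul1r tmulDl tmulDr.

Fact tens_neq0 : (1 : AB) != 0.
Proof.
have [f _ f1] := exists_linear_form (oner_neq0 A).
have [g _ g1] := exists_linear_form (oner_neq0 B).
pose h : AB -> C^o := tlift (@idfun C) (fun a b => f a * g b).
have fgDl a a' b : f (a + a') * g b = f a * g b + f a' * g b :> C^o.
  by rewrite linearD mulrDl.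
have fgDr a b b' : f a * g (b + b') = f a * g b + f a * g b' :> C^o.
  by rewrite linearD mulrDr.
have fgZl c a b : f (c *: a) * g b = c *: (f a * g b : C^o).
  by rewrite linearZ scalerAl.
have fgZr c a b : f a * g (c *: b) = c *: (f a * g b : C^o).
  by rewrite linearZ scalerAr.
have h1 : h (1 *t 1) = 1 by rewrite /h tlift_tens // f1 g1 mulr1.
have h0 : h 0 = 0 by rewrite /h tlift0.
apply/eqP=> AB1; have := oner_neq0 C.
by rewrite -[1]h1 -[1 *t 1]/(1 : AB) AB1 h0 eqxx.
Qed.

HB.instance Definition _ := GRing.PzSemiRing_isNonZero.Build AB tens_neq0.
HB.instance Definition _ := GRing.Lmodule_isLalgebra.Build C AB
  (fun c x y => esym (tmulZl c x y)).
HB.instance Definition _ := GRing.Lalgebra_isAlgebra.Build C AB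
  (fun c x y => esym (tmulZr c x y)).

Definition tstar (x : AB) : AB :=
  tlift (@Num.conj C) (fun a b => star a *t star b) x.

Fact tstar_tens a b : tstar (a *t b) = star a *t star b.
Proof.
by apply: tlift_tens => *;
  rewrite ?starD ?starZ ?tensDl ?tensDr ?tensZl ?tensZr.
Qed.
Fact tstarD : {morph tstar : x y / x + y}.
Proof.
by apply: tliftD => *; rewrite ?starD ?starZ ?tensDl ?tensDr ?tensZl ?tensZr.
Qed.
Fact tstarZ c x : tstar (c *: x) = c^* *: tstar x.
Proof.
by apply: tliftZ => *; rewrite ?starD ?starZ ?tensDl ?tensDr ?tensZl ?tensZr.
Qed.
Fact tstar0 : tstar 0 = 0.
Proof.
by apply: tlift0 => *; rewrite ?starD ?starZ ?tensDl ?tensDr ?tensZl ?tensZr.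
Qed.
Fact tstarK : involutive tstar.
Proof.
elim/tensor_ind=> [a b||x y hx hy|c x hx].
- by rewrite !tstar_tens !starK.
- by rewrite !tstar0.
- by rewrite !tstarD hx hy.
- by rewrite !tstarZ hx conjCK.
Qed.
Fact tstarM (x y : AB) : tstar (x * y) = tstar y * tstar x.
Proof.
change (tstar (tmul x y) = tmul (tstar y) (tstar x)).
elim/tensor_ind: x => [a b||x x' hx hx'|c x hx].
- elim/tensor_ind: y => [a' b'||y y' hy hy'|c y hy].
  + by rewrite tmul_tens !tstar_tens tmul_tens !starM.
  + by rewrite tmul0r tstar0 tmul0l.
  + by rewrite tmulDr !tstarD hy hy' tmulDl.
  + by rewrite tmulZr !tstarZ hy tmulZl.
- by rewrite tmul0l tstar0 tmul0r.
- by rewrite tmulDl !tstarD hx hx' tmulDr.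
- by rewrite tmulZl !tstarZ hx tmulZr.
Qed.

HB.instance Definition _ :=
  Algebra_isStarAlgebra.Build C AB tstarK tstarD tstarZ tstarM.

Lemma tens1 : 1 *t 1 = 1 :> AB. Proof. by []. Qed.
Lemma tensM (a a' : A) (b b' : B) :
  (a *t b) * (a' *t b') = (a * a') *t (b * b').
Proof. exact: tmul_tens. Qed.
Lemma tens_star (a : A) (b : B) : star (a *t b) = star a *t star b.
Proof. exact: tstar_tens. Qed.

End TensorAlgebra.

Definition tensmx (C : pzRingType) (A B : lmodType C) m n p
    (a : 'M[A]_(m, n)) (b : 'M[B]_(n, p)) : 'M[tensor A B]_(m, p) :=
  \matrix_(i < m, j < p) (\sum_(k < n) (a i k *t b k j)).

Notation "a *tm b" := (tensmx a b)
  (at level 40, left associativity) : ring_scope.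

Section QNumbers.
Variables (R : realType) (q : R).

Definition qint (n : nat) : R := (1 - q ^+ (2 * n)) / (1 - q ^+ 2).

Definition qbinom (n k : nat) : R :=
  (\prod_(k.+1 <= i < n.+1) (1 - q ^+ (2 * i))) /
  (\prod_(1 <= j < (n - k).+1) (1 - q ^+ (2 * j))).

End QNumbers.

Inductive S7gen := X1 | X2 | X3 | X4.

Section QuantumSphere.
Variables (R : realType) (q : R).

Local Notation tm := (staterm R[i] S7gen).
Local Notation x1 := (TGen X1 : tm).
Local Notation x2 := (TGen X2 : tm).
Local Notation x3 := (TGen X3 : tm).
Local Notation x4 := (TGen X4 : tm).
Local Notation "c *: s" := (TScale (c%R)%:C%C s) : staterm_scope.

Inductive S7rel : tm -> tm -> Prop :=
| S7_12 : S7rel (x1 * x2) (q *: (x2 * x1))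
| S7_13 : S7rel (x1 * x3) (q *: (x3 * x1))
| S7_14 : S7rel (x1 * x4) (q ^+ 2 *: (x4 * x1))
| S7_23 : S7rel (x2 * x3)
    (q ^+ 2 *: (x3 * x2) + (q ^+ 2 * (q - q^-1)) *: (x4 * x1))
| S7_24 : S7rel (x2 * x4) (q *: (x4 * x2))
| S7_34 : S7rel (x3 * x4) (q *: (x4 * x3))
| S7_s11 : S7rel (x1^* * x1) (x1 * x1^*)
| S7_s12 : S7rel (x1^* * x2) (q *: (x2 * x1^*))
| S7_s13 : S7rel (x1^* * x3) (q *: (x3 * x1^*))
| S7_s14 : S7rel (x1^* * x4) (q ^+ 2 *: (x4 * x1^*))
| S7_s22 : S7rel (x2^* * x2) (x2 * x2^* + (1 - q ^+ 2) *: (x1 * x1^*))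
| S7_s23 : S7rel (x2^* * x3) (q ^+ 2 *: (x3 * x2^*))
| S7_s24 : S7rel (x2^* * x4)
    (q *: (x4 * x2^*) + (q ^+ 2 * (q - q^-1)) *: (x3 * x1^*))
| S7_s33 : S7rel (x3^* * x3)
    (x3 * x3^* + (1 - q ^+ 4) *: (x2 * x2^*) + (1 - q ^+ 2) *: (x1 * x1^*))
| S7_s34 : S7rel (x3^* * x4)
    (q *: (x4 * x3^*) - (q ^+ 4 * (q - q^-1)) *: (x2 * x1^*))
| S7_sphere :
    S7rel (x1 * x1^* + x2 * x2^* + x3 * x3^* + x4 * x4^*) 1
| S7_sphere' :
    S7rel (q ^+ 8 *: (x1^* * x1) + q ^+ 6 *: (x2^* * x2)
           + q ^+ 2 *: (x3^* * x3) + x4^* * x4) 1.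

Definition OS7 : Type := presented S7rel.

Fact OS7_neq0 : (1 : presented S7rel) != 0.
Proof.
pose g i : R[i]^o := if i is X4 then 1 else 0.
apply: (@presented_neq0 _ _ _ _ g) => s t [] /=;
  by rewrite ?(star0, star1, mulr0, mul0r, mulr1, scaler0, addr0, add0r, oppr0).
Qed.

HB.instance Definition _ := GRing.PzRing.on OS7.
HB.instance Definition _ := GRing.Lmodule.on OS7.
HB.instance Definition _ := GRing.PzSemiRing_isNonZero.Build OS7 OS7_neq0.
HB.instance Definition _ :=
  GRing.Lmodule_isLalgebra.Build R[i] OS7 (@pscaleAl _ _ S7rel).
HB.instance Definition _ :=
  GRing.Lalgebra_isAlgebra.Build R[i] OS7 (@pscaleAr _ _ S7rel).
HB.instance Definition _ := Algebra_isStarAlgebra.Build R[i] OS7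
  (@pstarK _ _ S7rel) (@pstarD _ _ S7rel) (@pstarZ _ _ S7rel)
  (@pstarM _ _ S7rel).

Definition S7x (g : S7gen) : OS7 := pgen S7rel g.

Definition S7u : 'M[OS7]_(4, 2) := \matrix_(i < 4, j < 2)
  nth 0 (nth [::]
    [:: [:: q%:C%C *: S7x X1;                 q%:C%C *: S7x X2];
        [:: - (q ^+ 2)%:C%C *: star (S7x X2); (q ^+ 3)%:C%C *: star (S7x X1)];
        [:: - S7x X3;                         S7x X4];
        [:: star (S7x X4);                    q%:C%C *: star (S7x X3)]] i) j.

(* U_(m.+1) from U_(m): here n = m.+1 and n - k = m.+1 - k.  The column
   [colU k] is read as 0 outside 0..m. *)
Definition S7U_step (m r : nat) (U : 'M[OS7]_(r, m.+1)) :
    'M[OS7]_(4 * r, m.+2) :=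
  let colU k : 'cV[OS7]_r :=
    \col_i (if (k <= m)%N then U i (inord k) else 0) in
  \matrix_(i < 4 * r, k < m.+2)
   (((Num.sqrt (qint q m.+1))^-1)%:C%C *:
    ((q ^+ k * Num.sqrt (qint q (m.+1 - k)))%:C%C *:
       bulletmx (col 0 S7u) (colU k) i 0
     + (if k == 0%N :> nat then 0 else
       (Num.sqrt (qint q k))%:C%C *:
       bulletmx (col 1 S7u) (colU k.-1) i 0))).

(* Only the values for 0 < n are meaningful; the 1 x 1 matrix at n = 0 is
   never used, as U_(1) = u is not computed from it. *)
Fixpoint S7U (n : nat) : 'M[OS7]_(4 ^ n, n.+1) :=
  match n with
  | 0 => 1%:M
  | m.+1 => match m return 'M[OS7]_(4 ^ m, m.+1) -> 'M[OS7]_(4 ^ m.+1, m.+2)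
            with
            | 0 => fun _ => S7u
            | m'.+1 => fun U => S7U_step U
            end (S7U m)
  end.

End QuantumSphere.

Inductive SUgen := Alpha | Gamma.

Section QuantumSU2.
Variables (R : realType) (q : R).

Local Notation tm := (staterm R[i] SUgen).

Definition SUT1_term (i j : 'I_2) : tm :=
  nth 0%sta (nth [::]
    [:: [:: TGen Alpha; (- q%:C%C *: (TGen Gamma)^*)%sta];
        [:: TGen Gamma; ((TGen Alpha)^*)%sta]] i) j.

Local Notation T := SUT1_term.

Inductive SUrel : tm -> tm -> Prop :=
| SU_isometry i j :
    SUrel ((T 0 i)^* * T 0 j + (T 1 i)^* * T 1 j) (if i == j then TOne else TZero)
| SU_coisometry i j :
    SUrel (T i 0 * (T j 0)^* + T i 1 * (T j 1)^*) (if i == j then TOne else TZero).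

Definition OSU2 : Type := presented SUrel.

Fact OSU2_neq0 : (1 : presented SUrel) != 0.
Proof.
pose g i : R[i]^o := if i is Alpha then 1 else 0.
apply: (@presented_neq0 _ _ _ _ g) => s t [] i j;
  case: i => -[|[|//]] ? ; case: j => -[|[|//]] ? /=;
  by rewrite ?(star0, star1, mulr0, mul0r, mulr1, scaler0, addr0, add0r, oppr0).
Qed.

HB.instance Definition _ := GRing.PzRing.on OSU2.
HB.instance Definition _ := GRing.Lmodule.on OSU2.
HB.instance Definition _ := GRing.PzSemiRing_isNonZero.Build OSU2 OSU2_neq0.
HB.instance Definition _ :=
  GRing.Lmodule_isLalgebra.Build R[i] OSU2 (@pscaleAl _ _ SUrel).
HB.instance Definition _ :=
  GRing.Lalgebra_isAlgebra.Build R[i] OSU2 (@pscaleAr _ _ SUrel).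
HB.instance Definition _ := Algebra_isStarAlgebra.Build R[i] OSU2
  (@pstarK _ _ SUrel) (@pstarD _ _ SUrel) (@pstarZ _ _ SUrel)
  (@pstarM _ _ SUrel).

Definition SUalpha : OSU2 := pgen SUrel Alpha.
Definition SUgamma : OSU2 := pgen SUrel Gamma.

Definition SUT1 : 'M[OSU2]_2 := \matrix_(i < 2, j < 2)
  nth 0 (nth [::] [:: [:: SUalpha; - q%:C%C *: star SUgamma];
                      [:: SUgamma; star SUalpha]] i) j.

Definition is_SU_coproduct (Delta : starMorphism OSU2 (tensor OSU2 OSU2)) :
  Prop := map_mx Delta SUT1 = SUT1 *tm SUT1.

(* The second condition determines the columns of T from column 0, whose
   entries are linearly independent for 0 < q < 1. *)
Definition is_SU_corepmx (Delta : OSU2 -> tensor OSU2 OSU2) (n : nat)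
    (T : 'M[OSU2]_n.+1) : Prop :=
  (forall k : 'I_n.+1, T k 0 =
     (Num.sqrt (qbinom q n k))%:C%C *: (SUgamma ^+ k * SUalpha ^+ (n - k))) /\
  (forall k : 'I_n.+1, Delta (T k 0) = \sum_(j < n.+1) T k j *t T j 0).

End QuantumSU2.

(* The coaction is the only *-morphism with this value on u, because the
   entries of u and their adjoints generate O(S^7_q) when q != 0. *)
Definition is_S7_coaction (R : realType) (q : R)
    (deltaR : starMorphism (OS7 q) (tensor (OS7 q) (OSU2 q))) : Prop :=
  map_mx deltaR (S7u q) = S7u q *tm SUT1 q.

(* Main.v *)
(* U_(n+1) is the matrix (u ⊗ U_(n)) cg for the real matrix cg of
   q-Clebsch-Gordan coefficients embedding the spin (n+1)/2 corepresentation
   into T_(1) ⊗ T_(n).  As cg^* cg = 1, u^* u = 1 yields the isometry property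
   by induction.  Covariance reduces to the intertwining relation
   cg T_(n+1) = (T_(1) ⊗ T_(n)) cg, whose column 0 only expresses
   alpha gamma = q gamma alpha; applying Delta to column 0 and comparing the
   coefficients of the linearly independent gamma^k alpha^(n+1-k) in the second
   leg gives the other columns.  Linear independence is read off a
   representation in which alpha is diagonal and gamma a truncated shift. *)

Require Import Defs.
From HB Require Import structures.
From mathcomp Require Import all_boot all_order all_algebra.
From mathcomp Require Import complex.
From mathcomp Require Import boolp reals.
From mathcomp Require Import ring zify.

Set Implicit Arguments.
Unset Strict Implicit.
Unset Printing Implicit Defensive.

Import Order.TTheory GRing.Theory Num.Theory.

Local Open Scope ring_scope.

(** * Two-element indices, adjoints of sums and of real multiples *)

Lemma ord2_cases (k : 'I_2) : k = 0 \/ k = 1.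
Proof. by case: k => -[|[|//]] ?; [left|right]; apply/val_inj. Qed.

Lemma star_sum (C : numClosedFieldType) (A : starAlgType C) (I : finType)
    (F : I -> A) :
  star (\sum_i F i) = \sum_i star (F i).
Proof. by apply: big_morph; [exact: starD | exact: star0]. Qed.

Lemma star_real (R : realType) (A : starAlgType R[i]) (c : R) (a : A) :
  star (c%:C%C *: a) = c%:C%C *: star a.
Proof.
by rewrite starZ; congr (_ *: _); rewrite -[LHS]/(conjc _) conjc_real.
Qed.

(** * q-integers, q-binomials and the Clebsch-Gordan matrix [cg] *)

Section QNumbers.
Variables (R : realType) (q : R).
Hypotheses (hq0 : 0 < q) (hq1 : q < 1).

Lemma subr1Xn_gt0 n : (0 < n)%N -> 0 < 1 - q ^+ n.
Proof. by move=> n0; rewrite subr_gt0 exprn_ilt1 ?ltW // -lt0n. Qed.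

Lemma qint_ge0 n : 0 <= qint q n.
Proof.
by rewrite divr_ge0 // ?subr_ge0 ?exprn_ile1 ?ltW ?subr1Xn_gt0.
Qed.

Lemma qint_gt0 n : (0 < n)%N -> 0 < qint q n.
Proof. by move=> n0; rewrite divr_gt0 // subr1Xn_gt0 ?muln_gt0. Qed.

Lemma qint0 : qint q 0 = 0.
Proof. by rewrite /qint muln0 expr0 subrr mul0r. Qed.

(** The q-analogue of n = (n - k) + k; it makes the columns of [cg] unit vectors. *)
Lemma qint_split n k : (k <= n)%N ->
  (q ^+ k) ^+ 2 * qint q (n - k) + qint q k = qint q n.
Proof.
move=> kn; rewrite /qint mulrA -mulrDl -exprM mulnC mulrBr mulr1 -exprD.
by rewrite -mulnDr subnKC //; congr (_ / _); ring.
Qed.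

Lemma qprod_gt0 a b :
  (0 < a)%N -> 0 < \prod_(a <= i < b) (1 - q ^+ (2 * i)).
Proof.
move=> a0; rewrite big_seq; apply: prodr_gt0 => i.
rewrite mem_index_iota => /andP[ai _].
apply: subr1Xn_gt0; rewrite muln_gt0; exact: leq_trans a0 ai.
Qed.

Lemma qbinom_gt0 n k : 0 < qbinom q n k.
Proof. by rewrite divr_gt0 // qprod_gt0. Qed.

(** This ratio appears under the square roots when column 0 of T_(n) is multiplied by alpha;
    [qbinomSS] is its counterpart for gamma. *)
Lemma qbinomSn n k : (k <= n)%N ->
  qbinom q n k * qint q n.+1 = qint q (n.+1 - k) * qbinom q n.+1 k.
Proof.
move=> kn; rewrite /qbinom /qint subSn // 2?(big_nat_recr (_ + _)%N) //=.
rewrite (big_nat_recr n.+1) //= (big_nat_recr (n - k).+1) //=.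
have := lt0r_neq0 (@subr1Xn_gt0 2 isT).
have := lt0r_neq0 (@subr1Xn_gt0 (2 * (n - k).+1) isT).
have := lt0r_neq0 (@qprod_gt0 1 (n - k).+1 isT).
by move=> *; field; apply/and3P.
Qed.

Lemma qbinomSS n k : (k <= n)%N ->
  qbinom q n k * qint q n.+1 = qint q k.+1 * qbinom q n.+1 k.+1.
Proof.
move=> kn; rewrite /qbinom /qint subSS.
have E : \prod_(k.+1 <= i < n.+1) (1 - q ^+ (2 * i)) * (1 - q ^+ (2 * n.+1))
  = (1 - q ^+ (2 * k.+1)) * \prod_(k.+2 <= i < n.+2) (1 - q ^+ (2 * i)).
  by rewrite -big_nat_recr ?ltnS //= big_ltn // ltnS.
by rewrite mulrACA E [RHS]mulrACA; congr (_ * _); rewrite mulrC.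
Qed.

(* The nonzero coefficient of u^e • U_(n)^l in U_(n+1); it occurs in column
   l + e. *)
Definition cgw (n e l : nat) : R :=
  (if e == 0%N then q ^+ l * Num.sqrt (qint q (n.+1 - l))
   else Num.sqrt (qint q l.+1)) / Num.sqrt (qint q n.+1).

Definition cg n (e : 'I_2) (l : 'I_n.+1) (k : 'I_n.+2) : R[i] :=
  if k == (l + e)%N :> nat then (cgw n e l)%:C%C else 0.

Lemma cg_sumr (V : lmodType R[i]) n (e : 'I_2) (l : 'I_n.+1)
    (F : 'I_n.+2 -> V) :
  \sum_k cg e l k *: F k = (cgw n e l)%:C%C *: F (inord (l + e)%N).
Proof.
have le : (l + e < n.+2)%N.
  by rewrite -[n.+2]addn1; apply: leq_add (ltn_ord l) (leq_ord e).
rewrite (bigD1 (inord (l + e)%N)) //= {1}/cg inordK // eqxx big1 ?addr0 // => k.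
rewrite -val_eqE /= inordK // /cg => /negbTE ->.
by rewrite scale0r.
Qed.

(** Column [k] of [cg] meets only the rows (0, k) and (1, k - 1). The first is missing for k = n + 1
    and the second for k = 0, as in the conventions of the recursion for U_(n). *)
Lemma cg_suml (V : lmodType R[i]) n (k : 'I_n.+2) (G : 'I_2 -> 'I_n.+1 -> V) :
  \sum_e \sum_l cg e l k *: G e l =
    (if (k <= n)%N then (cgw n 0 k)%:C%C *: G 0 (inord k) else 0) +
    (if k == 0 :> nat then 0 else (cgw n 1 k.-1)%:C%C *: G 1 (inord k.-1)).
Proof.
rewrite big_ord_recl big_ord1; congr (_ + _).
- case: leqP => kn; last first.
    rewrite big1 // => l _; rewrite /cg addn0 ifN ?scale0r //.
    by rewrite neq_ltn (leq_trans (ltn_ord l) kn) orbT.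
  rewrite (bigD1 (inord k)) //= /cg addn0 inordK // eqxx big1 ?addr0 // => l.
  rewrite -val_eqE /= inordK // addn0 eq_sym => /negbTE ->.
  by rewrite scale0r.
- have -> : lift ord0 ord0 = 1 :> 'I_2 by apply/val_inj.
  case: eqP => [k0|/eqP k0].
    by rewrite big1 // => l _; rewrite /cg k0 addn1 scale0r.
  have kn : (k.-1 < n.+1)%N by rewrite -ltnS prednK ?lt0n // ltn_ord.
  rewrite (bigD1 (inord k.-1)) //= /cg inordK // addn1 prednK ?lt0n // eqxx.
  rewrite big1 ?addr0 // => l.
  rewrite -val_eqE /= inordK // addn1 => lk; rewrite ifN ?scale0r //.
  by apply: contraNneq lk => ->.
Qed.

(** Row (e, l) is nonzero only in column l + e, so distinct columns have disjoint supports; a column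
    has norm 1 by [qint_split]. The entries are real, so no conjugate appears. *)
Lemma cg_isometry n (k k' : 'I_n.+2) :
  \sum_e \sum_l cg e l k * cg e l k' = (k == k')%:R.
Proof.
case: (eqVneq k k') => [<-|kk']; last first.
  apply: big1 => e _; apply: big1 => l _; rewrite /cg.
  case: eqP => [kl|]; last by rewrite mul0r.
  case: eqP => [kl'|]; last by rewrite mulr0.
  by case/eqP: kk'; apply/val_inj; rewrite /= kl kl'.
have S m : Num.sqrt (qint q m) ^+ 2 = qint q m by rewrite sqr_sqrtr ?qint_ge0.
rewrite (@cg_suml R[i]^o n k (fun e l => cg e l k)).
have -> : (if (k <= n)%N then (cgw n 0 k)%:C%C *: cg 0 (inord k) k
           else 0 : R[i]^o)
    = ((q ^+ k) ^+ 2 * qint q (n.+1 - k) / qint q n.+1)%:C%C.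
  (* The absent term at k = n + 1 fits the formula because [qint q 0 = 0]. *)
  case: leqP => kn; last first.
    by rewrite (eqP (kn : (_ - _ == 0)%N)) qint0 mulr0 mul0r rmorph0.
  rewrite /cg inordK // addn0 eqxx -[_ *: _]rmorphM; congr (_ %:C)%C.
  by rewrite /cgw /= -expr2 !exprMn exprVn !S.
have -> : (if k == 0 :> nat then 0 : R[i]^o
           else (cgw n 1 k.-1)%:C%C *: cg 1 (inord k.-1) k)
    = (qint q k / qint q n.+1)%:C%C.
  case: (eqVneq (k : nat) 0%N) => [->|k0]; first by rewrite qint0 mul0r rmorph0.
  have kn : (k.-1 < n.+1)%N by rewrite -ltnS prednK ?lt0n // ltn_ord.
  rewrite /cg inordK // addn1 prednK ?lt0n // eqxx -[_ *: _]rmorphM.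
  by congr (_ %:C)%C; rewrite /cgw /= -expr2 !exprMn exprVn !S prednK ?lt0n.
rewrite -rmorphD -mulrDl qint_split -1?ltnS //.
by rewrite divff ?rmorph1 // lt0r_neq0 ?qint_gt0.
Qed.

End QNumbers.

(** * Sums in tensor products, and rows indexed by pairs *)

Lemma tens_suml (C : pzRingType) (A B : lmodType C) (I : finType)
    (F : I -> A) (b : B) :
  (\sum_i F i) *t b = \sum_i F i *t b.
Proof.
apply: (big_morph (fun a => a *t b)) => [x y|]; first exact: tensDl.
by rewrite -(scale0r 0) tensZl scale0r.
Qed.

Lemma tens_sumr (C : pzRingType) (A B : lmodType C) (I : finType)
    (F : I -> B) (a : A) :
  a *t (\sum_i F i) = \sum_i a *t F i.
Proof.
apply: (big_morph (fun b => a *t b)) => [x y|]; first exact: tensDr.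
by rewrite -(scale0r 0) tensZr scale0r.
Qed.

Lemma sum_mxvec_index (V : nmodType) m n (F : 'I_(m * n) -> V) :
  \sum_i F i = \sum_i \sum_j F (mxvec_index i j).
Proof.
rewrite pair_bigA /=.
rewrite (reindex (uncurry (@mxvec_index m n))); last exact: curry_mxvec_bij.
by apply: eq_bigr => -[i j] _.
Qed.

Lemma bulletmxE (A : pzRingType) m n (v : 'cV[A]_m) (w : 'cV[A]_n) i j :
  bulletmx v w (mxvec_index i j) 0 = v i 0 * w j 0.
Proof. by rewrite /bulletmx mxE mxvecE mxE. Qed.

(** * The isometry property of u, and its passage from U_(n) to U_(n+1) *)

Section Sphere.
Variables (R : realType) (q : R).
Hypotheses (hq0 : 0 < q) (hq1 : q < 1).

(** The recursion is the matrix product (u ⊗ U) cg: the terms dropped by convention are those where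
    [cg] has no entry. *)
Lemma S7U_stepE n r (U : 'M[OS7 q]_(r, n.+1)) i j k :
  S7U_step U (mxvec_index i j) k =
  \sum_e \sum_l cg q e l k *: (S7u q i e * U j l).
Proof.
rewrite cg_suml mxE scalerDr; congr (_ + _).
- rewrite bulletmxE !mxE; case: leqP => kn; last by rewrite mulr0 !scaler0.
  by rewrite scalerA -rmorphM mulrC.
- case: eqP => [|k0]; first by rewrite scaler0.
  have kn : (k.-1 <= n)%N by rewrite -ltnS prednK ?lt0n -1?ltnS //; exact/eqP.
  rewrite bulletmxE !mxE kn scalerA -rmorphM mulrC.
  by rewrite /cgw /= prednK // lt0n; apply/eqP.
Qed.

Lemma star_cg (A : starAlgType R[i]) n e (l : 'I_n.+1) k (a : A) :
  star (cg q e l k *: a) = cg q e l k *: star a.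
Proof.
by rewrite /cg; case: eqP => _; rewrite ?star_real // !scale0r star0.
Qed.

(** Evaluation at the generators is the class map, so each defining relation becomes an equation in
    O(S^7_q) that simplification makes explicit. *)
Lemma S7_evalrel s t : S7rel q s t -> staeval (S7x q) s = staeval (S7x q) t.
Proof.
have evalE u : staeval (S7x q) u = pclass (S7rel q) u.
  elim: u => //= [u -> v ->|u ->|c u ->|u -> v ->|u ->].
  - by rewrite pclassD.
  - by rewrite pclassN.
  - by rewrite pclassZ.
  - by rewrite pclassM.
  - by rewrite pclass_star.
by move=> st; rewrite !evalE; apply/pclassP; apply: sta_rel.
Qed.

(** After reordering, the diagonal entries are the two sphere relations. Entry (0, 1) cancels by the
    relations for x1^* x2 and x3^* x4, and entry (1, 0) is its adjoint. *)
Lemma S7u_isometry : adjmx (S7u q) *m S7u q = 1%:M.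
Proof.
have x11 := S7_evalrel (S7_s11 q); have x22 := S7_evalrel (S7_s22 q).
have x33 := S7_evalrel (S7_s33 q); have x12 := S7_evalrel (S7_s12 q).
have x34 := S7_evalrel (S7_s34 q); have s := S7_evalrel (S7_sphere q).
have s' := S7_evalrel (S7_sphere' q).
rewrite /= in x11 x22 x33 x12 x34 s s'.
have e01 : (adjmx (S7u q) *m S7u q) 0 1 = 0.
  rewrite mxE !big_ord_recl big_ord0 addr0 !mxE /=.
  rewrite scaleNr !(star_real, starN, starK).
  rewrite !(mulNr, =^~ scalerAl, =^~ scalerAr).
  rewrite x12 x34 opprB subrK !scalerA -!rmorphM -!scaleNr -!scalerDl.
  rewrite -!(rmorphM, rmorphN, rmorphD).
  have -> : q * q * q + (- (q ^+ 2 * q ^+ 3) + q ^+ 4 * (q - q^-1)) = 0.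
    by field; apply: lt0r_neq0.
  by rewrite scale0r.
have e00 : (adjmx (S7u q) *m S7u q) 0 0 = 1.
  rewrite mxE !big_ord_recl big_ord0 addr0 !mxE /=.
  rewrite scaleNr !(star_real, starN, starK).
  rewrite !(mulNr, mulrN, =^~ scalerAl, =^~ scalerAr).
  rewrite !opprK x11 x33 !scalerA -!rmorphM -s.
  (* Group the two multiples of x1 x1^* and the two of x2 x2^*. *)
  rewrite [LHS](AC (1*(1*(3*1))) ((1*5)*(2*4)*3*6)) /= -!scalerDl -!rmorphD.
  have -> : q * q + (1 - q ^+ 2) = 1 by ring.
  have -> : q ^+ 2 * q ^+ 2 + (1 - q ^+ 4) = 1 by ring.
  by rewrite !scale1r.
have e11 : (adjmx (S7u q) *m S7u q) 1 1 = 1.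
  rewrite mxE !big_ord_recl big_ord0 addr0 !mxE /=.
  rewrite !(star_real, starN, starK) !(=^~ scalerAl, =^~ scalerAr).
  rewrite -s' x11 x22 x33 !scalerDr !scalerA -!rmorphM.
  rewrite [LHS](AC (2*(1*2)) ((2*3)*1*5*4)) /= -!scalerDl -!rmorphD.
  rewrite [RHS](AC (1*2*3*1) ((1*3*6)*(2*5)*4*7)) /= -!scalerDl -!rmorphD.
  by congr (_%:C%C *: _ + _%:C%C *: _ + _ + _); ring.
have e10 : (adjmx (S7u q) *m S7u q) 1 0 = 0.
  rewrite -star0 -e01 !mxE star_sum; apply: eq_bigr => i _.
  by rewrite starM !mxE starK.
apply/matrixP => i j; rewrite [RHS]mxE.
by case: (ord2_cases i) => ->; case: (ord2_cases j) => ->.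
Qed.

Lemma isometryE (A : starAlgType R[i]) m p (V : 'M[A]_(m, p)) k k' :
  (adjmx V *m V) k k' = \sum_i star (V i k) * V i k'.
Proof. by rewrite mxE; apply: eq_bigr => i _; rewrite !mxE. Qed.

Lemma S7U_step_isometry n r (U : 'M[OS7 q]_(r, n.+1)) :
  adjmx U *m U = 1%:M -> adjmx (S7U_step U) *m S7U_step U = 1%:M.
Proof.
move=> UU; apply/matrixP => k k'.
(* The columns of u ⊗ U are orthonormal: in U^* u^* u U the factor u^* u stands in the middle, so it
   can be summed first without commuting anything. *)
have uU e e' l l' :
    \sum_i \sum_j star (S7u q i e * U j l) * (S7u q i e' * U j l') =
    (e == e')%:R * (l == l')%:R.
  transitivity (\sum_j star (U j l) * (\sum_i star (S7u q i e) * S7u q i e')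
                  * U j l').
    rewrite exchange_big; apply: eq_bigr => j _.
    rewrite mulr_sumr mulr_suml; apply: eq_bigr => i _.
    by rewrite starM !mulrA.
  rewrite -isometryE S7u_isometry mxE.
  case: eqP => _ /=; last first.
    by rewrite mul0r big1 // => j _; rewrite mulr0 mul0r.
  under eq_bigr do rewrite mulr1.
  by rewrite -isometryE UU mxE mul1r.
rewrite isometryE sum_mxvec_index.
(* Expand both columns through [cg] and move the sums over the rows innermost, where [uU] evaluates
   them. *)
transitivity (\sum_e \sum_l \sum_e' \sum_l' (cg q e l k * cg q e' l' k') *:
   ((e == e')%:R * (l == l')%:R : OS7 q)).
  under eq_bigr => i _.
    under eq_bigr => j _.
      rewrite !S7U_stepE star_sum mulr_suml.
      under eq_bigr => e _.
        rewrite star_sum mulr_suml.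
        under eq_bigr => l _.
          rewrite star_cg mulr_sumr.
          under eq_bigr => e' _.
            rewrite mulr_sumr.
            under eq_bigr => l' _ do
              rewrite -scalerAl -scalerAr scalerA.
            over.
          over.
        over.
      over.
    over.
  under eq_bigr do rewrite exchange_big.
  rewrite exchange_big; apply: eq_bigr => e _ /=.
  under eq_bigr do rewrite exchange_big.
  rewrite exchange_big; apply: eq_bigr => l _ /=.
  under eq_bigr do rewrite exchange_big.
  rewrite exchange_big; apply: eq_bigr => e' _ /=.
  under eq_bigr do rewrite exchange_big.
  rewrite exchange_big; apply: eq_bigr => l' _ /=.
  by rewrite -uU scaler_sumr; apply: eq_bigr => i _; rewrite scaler_sumr.
have -> : (1%:M : 'M[OS7 q]_n.+2) k k' = (k == k')%:R *: 1.
  by rewrite mxE scaler_nat.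
rewrite -(cg_isometry hq0 hq1 k k') scaler_suml; apply: eq_bigr => e _.
rewrite scaler_suml; apply: eq_bigr => l _.
rewrite (bigD1 e) //= (bigD1 l) //= !eqxx mulr1 !big1 ?addr0 //.
  move=> e' /negbTE ne; apply: big1 => l' _.
  by rewrite eq_sym ne mul0r scaler0.
by move=> l' /negbTE nl; rewrite [l == _]eq_sym nl mulr0 scaler0.
Qed.

End Sphere.

(** * A finite-dimensional *-representation of O(SU_q(2)) *)

(* Square matrices with the involution M |-> J M^* J, J the flip of the
   basis.  J is an indefinite form, which leaves room for a finite-dimensional
   *-representation of O(SU_q(2)) with gamma^n <> 0; for the usual involution
   gamma would be sent to 0. *)
Definition flipmx (C : numClosedFieldType) n : Type := 'M[C]_n.+1.

Section FlipMatrix.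
Variables (C : numClosedFieldType) (n : nat).

HB.instance Definition _ := GRing.Algebra.on (flipmx C n).

Definition flipstar (M : flipmx C n) : flipmx C n :=
  \matrix_(i, j) (M (rev_ord j) (rev_ord i))^*.

Fact flipstarK : involutive flipstar.
Proof. by move=> M; apply/matrixP => i j; rewrite !mxE !rev_ordK conjCK. Qed.

Fact flipstarD : {morph flipstar : M N / M + N}.
Proof. by move=> M N; apply/matrixP => i j; rewrite !mxE rmorphD. Qed.

Fact flipstarZ c (M : flipmx C n) : flipstar (c *: M) = c^* *: flipstar M.
Proof. by apply/matrixP => i j; rewrite !mxE rmorphM. Qed.

Fact flipstarM (M N : flipmx C n) :
  flipstar (M * N) = flipstar N * flipstar M.
Proof.
apply/matrixP => i j; rewrite !mxE rmorph_sum (reindex_inj rev_ord_inj) /=.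
by apply: eq_bigr => k _; rewrite !mxE rmorphM mulrC.
Qed.

HB.instance Definition _ := Algebra_isStarAlgebra.Build C (flipmx C n)
  flipstarK flipstarD flipstarZ flipstarM.

End FlipMatrix.

Section Representation.
Variables (R : realType) (q : R) (n : nat).
Hypothesis hq0 : 0 < q.

Local Notation M := (flipmx R[i] (n.*2).+1).

(* Upper half: alpha acts by q^-i and gamma by a shift, gamma^* by 0.  Lower
   half: the image of the upper one under the involution. *)
Definition SUrep_weight (i : 'I_(n.*2).+2) : R :=
  if (i <= n)%N then q ^- i else q ^+ rev_ord i.

Definition SUrep_alpha : M := diag_mx (\row_i (SUrep_weight i)%:C%C).

Definition SUrep_gamma : M :=
  \matrix_(i, j) ((j == i.+1 :> nat) && (j <= n)%N)%:R.

Definition SUrep_gen (g : SUgen) : M :=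
  if g is Alpha then SUrep_alpha else SUrep_gamma.

Lemma SUrep_weight_neq0 i : SUrep_weight i != 0.
Proof.
rewrite /SUrep_weight; case: ifP => _;
  by rewrite ?invr_eq0 expf_neq0 // lt0r_neq0.
Qed.

(** This symmetry of the weights makes alpha unitary for the flip involution. *)
Lemma SUrep_weight_rev i : SUrep_weight (rev_ord i) = (SUrep_weight i)^-1.
Proof.
rewrite /SUrep_weight; have := ltn_ord i.
case: (leqP (rev_ord i) n) => h1; case: (leqP i n) => h2;
  rewrite ?rev_ordK ?invrK //; move: h1 h2 => /=; lia.
Qed.

Lemma star_SUrep_alpha :
  star SUrep_alpha = diag_mx (\row_i (SUrep_weight i)^-1%:C%C).
Proof.
apply/matrixP => i j; rewrite !mxE (inj_eq rev_ord_inj) eq_sym.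
case: eqP => [->|_]; last by rewrite !mulr0n conjC0.
rewrite !mulr1n -SUrep_weight_rev.
by rewrite -[LHS]/(conjc _) conjc_real.
Qed.

(** The flip carries the shift to the lower half. Hence gamma and gamma^* live on complementary
    halves and both their products vanish. *)
Lemma star_SUrep_gamma :
  star SUrep_gamma =
  \matrix_(i, j) ((j == i.+1 :> nat) && (n < i)%N)%:R.
Proof.
apply/matrixP => i j; rewrite !mxE conjC_nat; congr _%:R.
have := ltn_ord i; have := ltn_ord j; rewrite /= => ? ?.
by congr nat_of_bool; apply/andP/andP => -[/eqP ? ?]; split; try apply/eqP; lia.
Qed.

Lemma SUrep_alphaV : SUrep_alpha * star SUrep_alpha = 1.
Proof.
rewrite star_SUrep_alpha; apply/matrixP => i j.
rewrite [_ * _]mul_diag_mx !mxE; case: eqP => [->|_]; last by rewrite mulr0.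
by rewrite !mulr1n -rmorphM divff ?SUrep_weight_neq0 ?rmorph1.
Qed.

Lemma SUrep_Valpha : star SUrep_alpha * SUrep_alpha = 1.
Proof.
rewrite star_SUrep_alpha; apply/matrixP => i j.
rewrite [_ * _]mul_diag_mx !mxE; case: eqP => [->|_]; last by rewrite mulr0.
by rewrite !mulr1n -rmorphM mulVf ?SUrep_weight_neq0 ?rmorph1.
Qed.

Lemma SUrep_gamma_star : SUrep_gamma * star SUrep_gamma = 0.
Proof.
rewrite star_SUrep_gamma; apply/matrixP => i j; rewrite !mxE big1 // => k _.
rewrite !mxE -natrM mulnb; case: andP => // -[/andP[/eqP ? ?] /andP[/eqP ? ?]].
lia.
Qed.

Lemma SUrep_star_gamma : star SUrep_gamma * SUrep_gamma = 0.
Proof.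
rewrite star_SUrep_gamma; apply/matrixP => i j; rewrite !mxE big1 // => k _.
rewrite !mxE -natrM mulnb; case: andP => // -[/andP[/eqP ? ?] /andP[/eqP ? ?]].
lia.
Qed.

Lemma SUrep_alphaMl (X : M) i j :
  (SUrep_alpha * X) i j = (SUrep_weight i)%:C%C * X i j.
Proof. by rewrite [_ * X]mul_diag_mx !mxE. Qed.

Lemma SUrep_alphaMr (X : M) i j :
  (X * SUrep_alpha) i j = X i j * (SUrep_weight j)%:C%C.
Proof. by rewrite [X * _]mul_mx_diag !mxE. Qed.

Lemma SUrep_alpha_gamma :
  SUrep_alpha * SUrep_gamma = q%:C%C *: (SUrep_gamma * SUrep_alpha).
Proof.
apply/matrixP => i j; rewrite [RHS]mxE SUrep_alphaMl SUrep_alphaMr !mxE.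
case: andP => [[/eqP ij jn]|]; last by rewrite mul0r !mulr0.
rewrite mulr1 mul1r -rmorphM /SUrep_weight jn ifT; last by lia.
by congr (_%:C)%C; rewrite ij exprS invfM mulrA divff ?mul1r // lt0r_neq0.
Qed.

Lemma SUrep_alpha_gamma_star :
  SUrep_alpha * star SUrep_gamma = q%:C%C *: (star SUrep_gamma * SUrep_alpha).
Proof.
rewrite star_SUrep_gamma; apply/matrixP => i j.
rewrite [RHS]mxE SUrep_alphaMl SUrep_alphaMr !mxE.
case: andP => [[/eqP ij jn]|]; last by rewrite mul0r !mulr0.
rewrite mulr1 mul1r -rmorphM /SUrep_weight !ifF; [|lia|lia].
congr (_%:C)%C; rewrite -exprS; congr (_ ^+ _); rewrite /= ij.
by have := ltn_ord j; lia.
Qed.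

(** As alpha is unitary and the products of gamma and gamma^* vanish, what remains is that alpha
    q-commutes with gamma and gamma^*, together with the adjoints of these two relations. *)
Lemma SUrep_rel s t :
  SUrel q s t -> staeval SUrep_gen s = staeval SUrep_gen t.
Proof.
have Sq (x : M) : star (- q%:C%C *: x) = - q%:C%C *: star x.
  by rewrite !scaleNr starN star_real.
have ag := SUrep_alpha_gamma; have ags := SUrep_alpha_gamma_star.
have aV := SUrep_alphaV; have Va := SUrep_Valpha.
have gs := SUrep_gamma_star; have sg := SUrep_star_gamma.
case=> i j; case: (ord2_cases i) => ->; case: (ord2_cases j) => -> /=;
  rewrite ?(Sq, starK) -?(scalerAl, scalerAr) ?(aV, Va, gs, sg).
all: rewrite ?scaler0 ?addr0 ?add0r //.
- have := congr1 star ag; rewrite starM star_real starM => ->.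
  by rewrite scaleNr addNr.
- by rewrite ag scaleNr addNr.
- by rewrite ags scaleNr addrN.
- have := congr1 star ags; rewrite starM star_real starM starK => ->.
  by rewrite scaleNr addrN.
Qed.

Definition SUrep (x : OSU2 q) : M := staeval SUrep_gen (repr x).

(** By [SUrep_rel] the representative chosen in [SUrep] does not matter. *)
Lemma SUrepE s : SUrep (pclass (SUrel q) s) = staeval SUrep_gen s.
Proof. exact: (staeval_congr (@SUrep_rel) (repr_pclass _ _)). Qed.

Lemma SUrepD : {morph SUrep : x y / x + y}.
Proof.
elim/pclassW=> s; elim/pclassW=> t.
by rewrite -[_ + _]pclassD !SUrepE.
Qed.

Lemma SUrepM : {morph SUrep : x y / x * y}.
Proof.
elim/pclassW=> s; elim/pclassW=> t.
by rewrite -[_ * _]pclassM !SUrepE.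
Qed.

Lemma SUrepZ c : {morph SUrep : x / c *: x}.
Proof. by elim/pclassW=> s; rewrite -[_ *: _]pclassZ !SUrepE. Qed.

Lemma SUrep1 : SUrep 1 = 1. Proof. exact: SUrepE. Qed.

Lemma SUrepX k : {morph SUrep : x / x ^+ k}.
Proof.
by move=> x; elim: k => [|k IHk]; rewrite ?SUrep1 // !exprS SUrepM IHk.
Qed.

Lemma SUrep_gammaX k j : (k <= n)%N ->
  (SUrep_gamma ^+ k) 0 j = (j == k :> nat)%:R.
Proof.
elim: k j => [|k IHk] j kn; first by rewrite mxE eq_sym.
rewrite exprSr mxE (bigD1 (inord k)) //= IHk 1?ltnW // !mxE inordK; last by lia.
rewrite eqxx mul1r big1 ?addr0.
  by congr _%:R; case: eqP => //= ->; rewrite kn.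
move=> i; rewrite -val_eqE /= inordK; last by lia.
by rewrite IHk 1?ltnW // => /negbTE ->; rewrite mul0r.
Qed.

(** Row 0 separates the powers of gamma: the shift sends it to column k, and the diagonal alpha only
    rescales. *)
Lemma SUrep_monomial k l j : (k <= n)%N ->
  SUrep (SUgamma q ^+ k * SUalpha q ^+ l) 0 j =
  if j == k :> nat then ((SUrep_weight j)%:C%C) ^+ l else 0.
Proof.
move=> kn; rewrite SUrepM !SUrepX !SUrepE /=.
elim: l => [|l IHl]; first by rewrite mulr1 SUrep_gammaX //; case: eqP.
rewrite exprSr mulrA SUrep_alphaMr IHl exprSr.
by case: eqP => // _; rewrite mul0r.
Qed.

End Representation.

(** * Column 0 of T_(n): linear independence and multiplication by alpha and gamma *)

Section Corepresentation.
Variables (R : realType) (q : R).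
Hypotheses (hq0 : 0 < q) (hq1 : q < 1).

Definition SUcol n k : OSU2 q :=
  (Num.sqrt (qbinom q n k))%:C%C *: (SUgamma q ^+ k * SUalpha q ^+ (n - k)).

(** Entry (0, j) of the representation is a functional that vanishes on every [SUcol n k] except k =
    j. Coefficients in an arbitrary module [V] are allowed, so that coproducts can be compared. *)
Lemma SUcol_free (V : lmodType R[i]) n (a b : 'I_n.+1 -> V) :
  \sum_k a k *t SUcol n k = \sum_k b k *t SUcol n k -> a =1 b.
Proof.
move=> ab j.
have jn : (j < n.*2.+2)%N by have := ltn_ord j; lia.
pose f (x : OSU2 q) : R[i] := SUrep n x 0 (Ordinal jn).
(* The lift of [h] to the tensor product is the slice map id ⊗ f. *)
pose h (v : V) (x : OSU2 q) := f x *: v.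
have hZ c v x : h v (c *: x) = c *: h v x.
  by rewrite /h /f SUrepZ // mxE scalerA.
have hE (c : 'I_n.+1 -> V) :
    tlift (@idfun R[i]) h (\sum_k c k *t SUcol n k) =
    (f (SUcol n j)) *: c j.
  have hDl v v' x : h (v + v') x = h v x + h v' x by rewrite /h scalerDr.
  have hDr v x y : h v (x + y) = h v x + h v y.
    by rewrite /h /f SUrepD // mxE scalerDl.
  have hZl d v x : h (d *: v) x = d *: h v x.
    by rewrite /h !scalerA mulrC.
  have tD := @tliftD _ _ _ _ (@idfun R[i]) h hDl hDr hZl hZ.
  have t0 := @tlift0 _ _ _ _ (@idfun R[i]) h hDl hDr hZl hZ.
  rewrite (big_morph _ tD t0).
  rewrite (bigD1 j) //= tlift_tens // big1 ?addr0 // => k kj.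
  rewrite tlift_tens // hZ /h /f SUrep_monomial -1?ltnS //=.
  by rewrite ifN ?scale0r ?scaler0 // eq_sym.
have fj : f (SUcol n j) != 0.
  rewrite /f SUrepZ // mxE SUrep_monomial -1?ltnS //= eqxx.
  rewrite mulf_neq0 ?expf_neq0 // fmorph_eq0 ?SUrep_weight_neq0 //.
  by rewrite gt_eqF // sqrtr_gt0 qbinom_gt0.
by have := congr1 (tlift (@idfun R[i]) h) ab; rewrite !hE => /(scalerI fj).
Qed.

Lemma SU_evalrel s t : SUrel q s t ->
  staeval (pgen (SUrel q) : _ -> OSU2 q) s =
  staeval (pgen (SUrel q) : _ -> OSU2 q) t.
Proof.
have evalE u : staeval (pgen (SUrel q) : _ -> OSU2 q) u = pclass (SUrel q) u.
  elim: u => //= [u -> v ->|u ->|c u ->|u -> v ->|u ->].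
  - by rewrite pclassD.
  - by rewrite pclassN.
  - by rewrite pclassZ.
  - by rewrite pclassM.
  - by rewrite pclass_star.
by move=> st; rewrite !evalE; apply/pclassP; apply: sta_rel.
Qed.

Lemma SU_alpha_gamma :
  SUalpha q * SUgamma q = q%:C%C *: (SUgamma q * SUalpha q).
Proof.
(* Entry (1, 0) of T_(1)^* T_(1) = 1 reads - q gamma alpha + alpha gamma = 0. *)
have /= := SU_evalrel (SU_isometry q 1 0).
rewrite scaleNr starN star_real !starK mulNr -scalerAl addrC => /eqP.
by rewrite subr_eq0 => /eqP.
Qed.

Lemma SUalpha_gammaX k :
  SUalpha q * SUgamma q ^+ k = (q ^+ k)%:C%C *: (SUgamma q ^+ k * SUalpha q).
Proof.
elim: k => [|k IHk]; first by rewrite mul1r mulr1 scale1r.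
rewrite exprSr mulrA IHk -scalerAl -[_ * _ * SUgamma q]mulrA SU_alpha_gamma.
by rewrite -scalerAr scalerA -rmorphM [q ^+ _.+1]exprSr mulrA.
Qed.

(** Column 0 of the intertwining relation. For e = 0, moving alpha past gamma^l yields the factor
    q^l of [cgw]; for e = 1 nothing has to be commuted. The square roots match by [qbinomSn] and
    [qbinomSS]. *)
Lemma SUT1_col n (e : 'I_2) (l : 'I_n.+1) :
  SUT1 q e 0 * SUcol n l = \sum_k cg q e l k *: SUcol n.+1 k.
Proof.
have ln : (l <= n)%N by rewrite -ltnS.
have b0 m k : 0 <= qbinom q m k by rewrite ltW ?qbinom_gt0.
have s1 : Num.sqrt (qint q n.+1) != 0 by rewrite gt_eqF // sqrtr_gt0 qint_gt0.
have := ltn_ord e; rewrite cg_sumr /SUcol !scalerA -rmorphM.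
rewrite inordK; last by have := ltn_ord l; have := ltn_ord e; lia.
rewrite mxE /cgw; case: e => -[|[|//]] e2 _ /=.
- rewrite addn0 subSn // exprSr -scalerAr !mulrA SUalpha_gammaX.
  rewrite -scalerAl scalerA -rmorphM -!mulrA -exprS;
    congr (_%:C%C *: _); last by rewrite exprSr.
  rewrite mulrC; congr (_ * _); rewrite mulrCA mulrC.
  apply/(canRL (mulfK s1)); rewrite -!sqrtrM ?qint_ge0 ?b0 //.
  by rewrite qbinomSn // subSn.
- rewrite addn1 subSS -scalerAr mulrA -exprS; congr (_%:C%C *: _).
  rewrite mulrAC; apply/(canRL (mulfK s1)).
  by rewrite -!sqrtrM ?qint_ge0 ?b0 // qbinomSS.
Qed.

(** * Existence of the matrices T_(n) and the intertwining relation *)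

Section Coproduct.
Variable Delta : starMorphism (OSU2 q) (tensor (OSU2 q) (OSU2 q)).
Hypothesis hDelta : is_SU_coproduct Delta.

Lemma SU_coprodE i j : Delta (SUT1 q i j) = \sum_e SUT1 q i e *t SUT1 q e j.
Proof. by move/matrixP/(_ i j): hDelta; rewrite !mxE. Qed.

(* The entries of (T_(1) ⊗ T) cg. *)
Definition SUT_tens n (T : 'M[OSU2 q]_n.+1) i j k :=
  \sum_e \sum_l cg q e l k *: (SUT1 q i e * T j l).

(** The second legs of the product of the two coproducts are products of column 0 entries, which
    [SUT1_col] expands in [SUcol n.+1]. *)
Lemma coprod_SUT_tens n (T : 'M[OSU2 q]_n.+1) i j :
  is_SU_corepmx Delta T ->
  Delta (SUT1 q i 0 * T j 0) = \sum_k SUT_tens T i j k *t SUcol n.+1 k.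
Proof.
move=> [T0 DT]; rewrite rmorphM /= DT SU_coprodE mulr_suml.
under [RHS]eq_bigr do rewrite tens_suml.
rewrite exchange_big; apply: eq_bigr => e _ /=.
rewrite mulr_sumr; under [RHS]eq_bigr do rewrite tens_suml.
rewrite exchange_big; apply: eq_bigr => l _ /=.
rewrite tensM T0 -/(SUcol n l) SUT1_col tens_sumr.
by apply: eq_bigr => k _; rewrite tensZl tensZr.
Qed.

(** Column 0 of [cg] is the unit vector at (0, 0). *)
Lemma SUT_tens0 n (T : 'M[OSU2 q]_n.+1) i j :
  SUT_tens T i j 0 = SUT1 q i 0 * T j 0.
Proof.
rewrite /SUT_tens cg_suml /= addr0 /cgw /= expr0 mul1r subn0 divff ?scale1r.
  by congr (_ * T _ _); apply/val_inj; rewrite /= inordK.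
by rewrite gt_eqF // sqrtr_gt0 qint_gt0.
Qed.

(** Induction on n, starting from T_(0) = 1, with T_(n+1) obtained by compressing T_(1) ⊗ T_(n) to
    the range of [cg]. *)
Lemma SU_corepmx_exists n :
  exists T : 'M[OSU2 q]_n.+1, is_SU_corepmx Delta T.
Proof.
elim: n => [|n [T' hT']].
  exists 1%:M; split=> k; rewrite ord1.
    rewrite mxE eqxx mulr1 /qbinom !big_geq // divff ?oner_eq0 //.
    by rewrite sqrtr1 scale1r.
  by rewrite big_ord1 !mxE eqxx rmorph1.
(* This is cg^* (T_(1) ⊗ T_(n)) cg. *)
pose T : 'M[OSU2 q]_n.+2 :=
  \matrix_(k, k') \sum_i \sum_j cg q i j k *: SUT_tens T' i j k'.
(* By [SUT1_col], column 0 is cg^* cg applied to [SUcol n.+1]. *)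
have T0 k : T k 0 = SUcol n.+1 k.
  transitivity (\sum_k' (k == k')%:R *: SUcol n.+1 k').
    under [RHS]eq_bigr do rewrite -(cg_isometry hq0 hq1) scaler_suml.
    rewrite mxE [RHS]exchange_big; apply: eq_bigr => i _ /=.
    under [RHS]eq_bigr do rewrite scaler_suml.
    rewrite [RHS]exchange_big; apply: eq_bigr => j _ /=.
    rewrite SUT_tens0 hT'.1 -/(SUcol n j) SUT1_col scaler_sumr.
    by apply: eq_bigr => k' _; rewrite scalerA.
  rewrite (bigD1 k) //= eqxx scale1r big1 ?addr0 // => k' /negbTE kk'.
  by rewrite eq_sym kk' scale0r.
exists T; split=> k; first exact: T0.
rewrite mxE rmorph_sum; under [RHS]eq_bigr do rewrite T0 mxE tens_suml.
rewrite [RHS]exchange_big; apply: eq_bigr => i _ /=.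
rewrite rmorph_sum; under [RHS]eq_bigr do rewrite tens_suml.
rewrite [RHS]exchange_big; apply: eq_bigr => j _ /=.
rewrite linearZ /= SUT_tens0 coprod_SUT_tens // scaler_sumr.
by apply: eq_bigr => k' _; rewrite tensZl.
Qed.

(** Both sides are the coefficients of [Delta (SUT1 q i 0 * T' j 0)] along [SUcol n.+1]: one from
    expanding the product before applying [Delta], the other from multiplicativity of [Delta]. *)
Lemma SUT_intertwine n (T' : 'M[OSU2 q]_n.+1) (T : 'M[OSU2 q]_n.+2) i j k :
  is_SU_corepmx Delta T' -> is_SU_corepmx Delta T ->
  \sum_k' cg q i j k' *: T k' k = SUT_tens T' i j k.
Proof.
move=> hT' [T0 DT].
apply: (SUcol_free
  (a := fun k => \sum_k' cg q i j k' *: T k' k) (b := SUT_tens T' i j)).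
rewrite -coprod_SUT_tens // hT'.1 -/(SUcol n j) SUT1_col rmorph_sum.
under eq_bigr do rewrite tens_suml.
rewrite exchange_big; apply: eq_bigr => k' _ /=.
rewrite linearZ /= -[SUcol _ _]T0 DT scaler_sumr.
by apply: eq_bigr => k'' _; rewrite tensZl T0.
Qed.

(** T_(1) has the prescribed column 0, since both q-binomials are 1; comparing two expansions of its
    coproduct then fixes the other column. *)
Lemma SU_corepmx1 (T : 'M[OSU2 q]_2) : is_SU_corepmx Delta T -> T = SUT1 q.
Proof.
move=> [T0 DT]; apply/matrixP => i j.
have S0 k : SUT1 q k 0 = SUcol 1 k.
  rewrite /SUcol mxE /qbinom; case: k => -[|[|//]] k2 /=.
    rewrite divff ?sqrtr1 ?scale1r ?mul1r //.
    by rewrite lt0r_neq0 // qprod_gt0.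
  by rewrite !big_geq // divr1 sqrtr1 scale1r mulr1.
apply: (SUcol_free (a := T i) (b := SUT1 q i)).
transitivity (Delta (SUT1 q i 0)).
  by rewrite S0 -[SUcol _ _]T0 DT; apply: eq_bigr => k _; rewrite T0.
by rewrite SU_coprodE; apply: eq_bigr => k _; rewrite S0.
Qed.

(** * Covariance of U_(n) by induction *)

Section Coaction.
Variable deltaR : starMorphism (OS7 q) (tensor (OS7 q) (OSU2 q)).
Hypothesis hdeltaR : is_S7_coaction deltaR.

Lemma S7U_step_coaction n r (U : 'M[OS7 q]_(r, n.+1)) (T' : 'M[OSU2 q]_n.+1)
    (T : 'M[OSU2 q]_n.+2) :
  is_SU_corepmx Delta T' -> is_SU_corepmx Delta T ->
  map_mx deltaR U = U *tm T' ->
  map_mx deltaR (S7U_step U) = S7U_step U *tm T.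
Proof.
move=> hT' hT hU; apply/matrixP => x k.
case/mxvec_indexP: x => i j; rewrite [LHS]mxE [RHS]mxE S7U_stepE.
have DU j' l : deltaR (U j' l) = \sum_l' U j' l' *t T' l' l.
  by move/matrixP/(_ j' l): hU; rewrite !mxE.
have Du e : deltaR (S7u q i e) = \sum_e' S7u q i e' *t SUT1 q e' e.
  by move/matrixP/(_ i e): hdeltaR; rewrite !mxE.
under [RHS]eq_bigr do rewrite S7U_stepE tens_suml.
rewrite [RHS]exchange_big /=.
(* Multiplicativity of [deltaR] leaves [cg] to the right of T_(1) ⊗ T_(n) in the second leg; the
   intertwining relation then moves it to the left, from where it passes into the first leg. *)
transitivity (\sum_e' \sum_l' (S7u q i e' * U j l') *t SUT_tens T' e' l' k).
  rewrite rmorph_sum /=.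
  under eq_bigr => e _.
    rewrite rmorph_sum /=.
    under eq_bigr => l _.
      rewrite linearZ /= rmorphM /= Du DU mulr_suml scaler_sumr.
      under eq_bigr => e' _.
        rewrite mulr_sumr scaler_sumr.
        under eq_bigr => l' _ do rewrite tensM.
        over.
      over.
    rewrite exchange_big /=.
    over.
  rewrite exchange_big; apply: eq_bigr => e' _ /=.
  under eq_bigr do rewrite exchange_big.
  rewrite exchange_big; apply: eq_bigr => l' _ /=.
  rewrite tens_sumr; apply: eq_bigr => e _.
  by rewrite tens_sumr; apply: eq_bigr => l _; rewrite tensZr.
apply: eq_bigr => e _; under [RHS]eq_bigr do rewrite tens_suml.
rewrite [RHS]exchange_big; apply: eq_bigr => l _ /=.
rewrite -(SUT_intertwine _ _ _ hT' hT) tens_sumr.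
by apply: eq_bigr => k' _; rewrite tensZl tensZr.
Qed.

End Coaction.
End Coproduct.
End Corepresentation.

Theorem proposition5p8 (R : realType) (q : R) (hq0 : 0 < q) (hq1 : q < 1)
  (Delta : starMorphism (OSU2 q) (tensor (OSU2 q) (OSU2 q)))
  (hDelta : is_SU_coproduct Delta)
  (deltaR : starMorphism (OS7 q) (tensor (OS7 q) (OSU2 q)))
  (hdeltaR : is_S7_coaction deltaR)
  (n : nat) (hn : (0 < n)%N)
  (T : 'M[OSU2 q]_n.+1) (hT : is_SU_corepmx Delta T) :
  adjmx (S7U q n) *m S7U q n = 1%:M /\
  map_mx deltaR (S7U q n) = S7U q n *tm T.
Proof.
(* After the shift of n both inductions start at U_(1) = u. *)
case: n hn T hT => // n _ T hT; split.
  elim: n {T hT} => [|n IHn]; first exact: S7u_isometry.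
  exact: S7U_step_isometry.
elim: n T hT => [|n IHn] T hT; first by rewrite (SU_corepmx1 hq0 hq1 hDelta hT).
(* Only the matrix of the current level is given; the one a level below, needed for the induction
   hypothesis, is constructed. *)
have [T' hT'] := SU_corepmx_exists hq0 hq1 hDelta n.+1.
exact: S7U_step_coaction hT' hT (IHn _ hT').
Qed.
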